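(* Let $(L/K,v)$ be a finite valued field extension with ${\rm rk}(v)=1$ and let $p$ be the (positive) characteristic of the residue field $Kv$. Assume that either (Artin–Schreier case) $L=K(\eta)$ is an Artin–Schreier extension of $K$, the minimal polynomial of $\eta$ over $K$ is $g=x^p-x-a$ (with $a\in K$), and $d(L/K,v)=p$; or (Kummer case) $K$ contains a primitive $p$-th root of unity, $L=K(\eta)$ is a Kummer extension of $K$, the minimal polynomial of $\eta$ over $K$ is $g=x^p-a$ (with $a\in K$), $v(a)=0$ and $d(L/K,v)=p$. Consider the valuation $\nu$ on $K[x]$ with support $gK[x]$ induced by $v$. Then there is exactly one plateau for $\nu$, namely $\Psi_1$, and $d(\Psi_1)=p$. Moreover, $\Psi_1$ is bounded in $\Gamma$, and, with $I_1\subseteq\{0\}$ the set attached to the plateau $\Psi_1$ (see context), $$I_1=\emptyset\quad\text{if and only if}\quad (L/K,v)\text{ is dependent.}$$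
   Context: Conventions: $(L/K,v)$ means that $v$ is a valuation on $L$ (and, by restriction, on $K$). $vL$ is the value group, $\Gamma$ is the divisible closure of $vL$. The defect $d(L/K,v)$ is defined as usual by $[L^h:K^h]=d(L/K,v)\,(vL:vK)\,[Lv:Kv]$, with $L^h,K^h$ henselizations; in both cases above $d(L/K,v)=p=[L:K]$ forces $vL=vK$ and $Lv=Kv$. The valuation $\nu$: $\nu(f):=v(f(\eta))$ for $f\in K[x]$. Key polynomials: fix an algebraic closure $\overline K$ of $K$ and an extension $\overline\nu$ of $\nu$ to $\overline K[x]$. For $f\in K[x]$ set $\epsilon(f):=\max\{\overline\nu(x-a)\mid a\in\overline K\text{ a root of }f\}$ (with $\epsilon(f)=-\infty$ for nonzero constants). A monic $Q\in K[x]$ of positive degree is a key polynomial for $\nu$ if $\deg(f)<\deg(Q)$ implies $\epsilon(f)<\epsilon(Q)$ for all nonzero $f\in K[x]$. $\Psi_n$ is the set of all key polynomials for $\nu$ of degree $n$. $\Psi_n$ has no maximum, resp. is bounded in $\Gamma$, if $\nu(\Psi_n)$ has no maximum, resp. has an upper bound in $\Gamma$. A key polynomial for $\Psi_n$ is a key polynomial for $\nu$ of smallest degree larger than $n$. If $\Psi_n$ is nonempty and has no maximum, it is called a plateau for $\nu$ and key polynomials for $\Psi_n$ are called limit key polynomials for $\Psi_n$. For a key polynomial $Q$ and $f\in K[x]$, write the $Q$-expansion $f=\sum_i a_{Qi}(f)Q^i$ with $\deg a_{Qi}(f)<\deg Q$; $L_Q(f)=\{i\in\mathbb N_0\mid a_{Qi}(f)\ne0\}$;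 $\nu_Q(f)=\min_{i\in L_Q(f)}\nu(a_{Qi}(f)Q^i)$, which is a valuation. Defect of a plateau: let $\mathcal G_Q=\bigoplus_{\gamma}\{f\mid\nu_Q(f)\ge\gamma\}/\{f\mid\nu_Q(f)>\gamma\}$ be the graded ring of $\nu_Q$, ${\rm in}_Q(f)$ the initial form of $f$, $R_Q$ the additive subgroup generated by the ${\rm in}_Q(f)$ with $\deg f<\deg Q$, and $y_Q={\rm in}_Q(Q)$. It is known that $R_Q$ is a ring, $y_Q$ is transcendental over $R_Q$ and $\mathcal G_Q=R_Q[y_Q]$. Put $\deg_Q(f):=\deg_{y_Q}({\rm in}_Q(f))$. For a plateau $\Psi_n$ with limit key polynomial $F$, $d(\Psi_n):=\lim_{Q\in\Psi_n}\deg_Q(F)$ (the eventual constant value for $\nu(Q)$ large). The set $I_1$: given the bounded plateau $\Psi_1$ with $d(\Psi_1)=p^{1}$, $I_1$ is the unique subset of $\{0\}$ such that for every limit key polynomial $F$ for $\Psi_1$ there exists $Q_1\in\Psi_1$ such that for every $Q\in\Psi_1$ with $\nu(Q)\ge\nu(Q_1)$ one has: $\{p^j\mid j\in I_1\}\subseteq L_Q(F)$, and $a_{Q0}(F)+\sum_{j\in I_1}a_{Qp^j}(F)Q^{p^j}+Q^{p}$ is a limit key polynomial for $\Psi_1$. (Existence and uniqueness of such a set holds for bounded plateaus in rank one.) Cuts and (in)dependence: a cut on $\Gamma$ is given by its lower cut set. For $S\subseteq\Gamma\cup\{\infty\}$, $\overline S$ is the cut with lower cut set $\{\gamma\in\Gamma\mid\exists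 s\in S,\ \gamma\le s\}$ and $S^-$ is the cut with lower cut set $\{\gamma\in\Gamma\mid\gamma<s\text{ for every }s\in S\}$. For $\alpha\in\Gamma$, $\alpha+S^-$ is the cut whose lower cut set is that of $S^-$ translated by $\alpha$. The distance of $\eta$ to $K$ is the cut ${\rm dist}(\eta,K)=\overline{\{v(\eta-b)\mid b\in K\}}$. In the Artin–Schreier case, $(L/K,v)$ is independent if ${\rm dist}(\eta,K)=H^-$ for some convex subgroup $H$ of $\Gamma$. In the Kummer case, $(L/K,v)$ is independent if ${\rm dist}(\eta,K)=\frac{v(p)}{p-1}+H^-$ for some convex subgroup $H$ of $\Gamma$. Otherwise it is dependent.
   Formalization: Here I_1 is the least subset of {0} with the stated property, not ''the unique'' one: for dependent Kummer extensions both the empty set and {0} have the property, so uniqueness fails there; whenever the set is unique, it is this one. *)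

(* Defs.v *)
From HB Require Import structures.
From mathcomp Require Import all_boot all_order all_algebra all_field.
From mathcomp Require Import boolp classical_sets.
Set Implicit Arguments.
Unset Strict Implicit.
Unset Printing Implicit Defensive.
Import Order.TTheory GRing.Theory Num.Theory.
Local Open Scope quotient_scope.
Local Open Scope classical_set_scope.
Local Open Scope ring_scope.

(* A totally ordered abelian group. The order is only declared as a partial
   order: joining [Zmodule] with the lattice structures would clash with the
   hierarchy below [realDomainType]. *)
HB.mixin Record isOrderedGroup G of Num.POrderedZmodule G := {
  og_le_total : total (<=%R : rel G);
  og_leD2l : forall x y z : G, x <= y -> z + x <= z + y
}.

#[short(type="orderedGroupType")]
HB.structure Definition OrderedGroup :=
  {G of Num.POrderedZmodule G & isOrderedGroup G}.

(* [ext G] is the group with two infinities added; a valuation never takes the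
   value [NInf], which is only needed as the maximum of the empty set. *)
Inductive ext (G : Type) := NInf | Fin of G | PInf.
Arguments NInf {G}.
Arguments PInf {G}.

Section Ext.
Variable G : orderedGroupType.
Implicit Types x y z : ext G.

Definition ext_enc x : option G + bool :=
  match x with NInf => inr false | Fin g => inl (Some g) | PInf => inr true end.
Definition ext_dec (c : option G + bool) : ext G :=
  match c with
  | inr false => NInf | inl (Some g) => Fin g | _ => PInf
  end.
Lemma ext_encK : cancel ext_enc ext_dec. Proof. by case. Qed.
HB.instance Definition _ := Choice.copy (ext G) (can_type ext_encK).

Definition ext_le x y : bool :=
  match x, y with
  | NInf, _ => true
  | _, PInf => true
  | Fin g, Fin h => g <= h
  | _, _ => false
  end.

Lemma ext_le_refl : reflexive ext_le. Proof. by case=> //= g. Qed.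
Lemma ext_le_anti : antisymmetric ext_le.
Proof. by move=> [|g|] [|h|] //= /le_anti ->. Qed.
Lemma ext_le_trans : transitive ext_le.
Proof. by move=> [|g|] [|h|] [|k|] //=; apply: le_trans. Qed.
Lemma ext_le_total : total ext_le.
Proof. by move=> [|g|] [|h|] //=; apply: og_le_total. Qed.

HB.instance Definition _ :=
  Order.Le_isPOrder.Build ring_display (ext G)
    ext_le_refl ext_le_anti ext_le_trans.
HB.instance Definition _ :=
  Order.POrder_isTotal.Build ring_display (ext G) ext_le_total.

Definition ext_add x y : ext G :=
  match x, y with
  | NInf, _ | _, NInf => NInf
  | Fin g, Fin h => Fin (g + h)
  | _, _ => PInf
  end.

End Ext.

Record valuation (R : comNzRingType) (G : orderedGroupType) := Valuation {
  vfun :> R -> ext G;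
  val0 : vfun 0 = PInf;
  val1 : vfun 1 = Fin 0;
  valM : forall x y, vfun (x * y) = ext_add (vfun x) (vfun y);
  valD : forall x y, Order.min (vfun x) (vfun y) <= vfun (x + y);
  val_nNInf : forall x, vfun x <> NInf
}.

Section ExtTheory.
Variable G : orderedGroupType.
Implicit Types (g h : G) (x y : ext G).

Lemma ext_leE x y : (x <= y) = ext_le x y. Proof. by []. Qed.

Lemma og_ltD2l g h k : h < k -> g + h < g + k.
Proof.
rewrite !lt_neqAle => /andP[ne le]; rewrite og_leD2l // andbT.
by apply: contra ne => /eqP/addrI->.
Qed.

Lemma og_leD g h k l : g <= k -> h <= l -> g + h <= k + l.
Proof.
move=> gk hl; apply: (le_trans (og_leD2l _ _ g hl)).
by rewrite ![_ + l]addrC og_leD2l.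
Qed.

Lemma Fin_lt x g : (Fin g < x) = match x with NInf => false
  | Fin h => g < h | PInf => true end.
Proof.
rewrite lt_neqAle ext_leE; case: x => [|h|] //=.
by rewrite lt_neqAle; congr andb; apply/eqP/eqP => [A ?|A [?]]; subst; apply: A.
Qed.

Lemma ext_leD g h x y : Fin g <= x -> Fin h <= y -> Fin (g + h) <= ext_add x y.
Proof. by rewrite !ext_leE; case: x y => [|k|] [|l|] //=; apply: og_leD. Qed.

Lemma ext_ltD g h x y : Fin g < x -> Fin h <= y -> Fin (g + h) < ext_add x y.
Proof.
rewrite !Fin_lt ext_leE; case: x y => [|k|] [|l|] //= gk hl.
apply: (le_lt_trans (og_leD2l _ _ g hl)).
by rewrite ![_ + l]addrC og_ltD2l.
Qed.
End ExtTheory.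

Section ValuationTheory.
Variables (R : comNzRingType) (G : orderedGroupType) (v : valuation R G).

Lemma valN1 : v (-1) = Fin 0.
Proof.
have := valM v (-1) (-1); rewrite mulrNN mulr1 val1.
case: (v (-1)) => [|g|] //= [] g0; congr Fin; apply: le_anti.
have [gn|gp] := orP (og_le_total g 0).
  by rewrite gn; have := og_leD2l _ _ g gn; rewrite addr0 -g0.
by rewrite gp andbT; have := og_leD2l _ _ g gp; rewrite addr0 -g0.
Qed.

Lemma valN x : v (- x) = v x.
Proof.
rewrite -mulN1r valM valN1; case: (v x) => //= g.
by rewrite add0r.
Qed.

Lemma val_leD g x y : g <= v x -> g <= v y -> g <= v (x + y).
Proof. by move=> gx gy; apply: le_trans (valD v x y); rewrite le_min gx. Qed.

Lemma val_ltD g x y : g < v x -> g < v y -> g < v (x + y).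
Proof. by move=> gx gy; apply: lt_le_trans (valD v x y); rewrite lt_min gx. Qed.

Lemma val_lt_sum (I : Type) (s : seq I) (P : pred I) (F : I -> R) (g : G) :
  (forall i, P i -> Fin g < v (F i)) -> Fin g < v (\sum_(i <- s | P i) F i).
Proof.
move=> h; apply: (big_ind (fun x => Fin g < v x)) => //; first by rewrite val0 Fin_lt.
by move=> x y; apply: val_ltD.
Qed.
End ValuationTheory.

Section Comap.
Variables (R S : comNzRingType) (G : orderedGroupType).
Variables (f : {rmorphism R -> S}) (v : valuation S G).

Fact comap0 : v (f 0) = PInf. Proof. by rewrite rmorph0 val0. Qed.
Fact comap1 : v (f 1) = Fin 0. Proof. by rewrite rmorph1 val1. Qed.
Fact comapM x y : v (f (x * y)) = ext_add (v (f x)) (v (f y)).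
Proof. by rewrite rmorphM valM. Qed.
Fact comapD x y : Order.min (v (f x)) (v (f y)) <= v (f (x + y)).
Proof. by rewrite rmorphD valD. Qed.
Fact comapN x : v (f x) <> NInf. Proof. exact: val_nNInf. Qed.

Definition comap : valuation R G := Valuation comap0 comap1 comapM comapD comapN.
End Comap.

Definition subgroup (V : zmodType) (H : set V) : Prop :=
  H 0 /\ forall x y, H x -> H y -> H (x - y).

Section Groups.
Variable G : orderedGroupType.
Implicit Types A B H : set G.

Definition convex_subgroup A H : Prop :=
  [/\ subgroup H, H `<=` A & forall x y, H x -> A y -> 0 <= y <= x -> H y].

(* exactly one proper convex subgroup, necessarily the trivial one *)
Definition rank_one A : Prop :=
  forall H, (convex_subgroup A H /\ H <> A) <-> H = [set 0].

Definition divisible_closure A : Prop :=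
  (forall (n : nat) (g : G), (0 < n)%N -> exists h, h *+ n = g) /\
  (forall g : G, exists2 n : nat, (0 < n)%N & A (g *+ n)).

Definition index_is A B (n : nat) : Prop :=
  exists t : 'I_n -> G, (forall i, B (t i)) /\
    forall b, B b -> exists! i, A (b - t i).

Definition value_group (R : comNzRingType) (v : valuation R G) : set G :=
  [set g | exists x, v x = Fin g].

(* Cuts are represented by their lower cut sets. *)
Definition cut_up (S : set (ext G)) : set G :=
  [set g | exists2 s, S s & Fin g <= s].
Definition cut_minus (S : set (ext G)) : set G :=
  [set g | forall s, S s -> Fin g < s].
Definition cut_shift (alpha : G) (C : set G) : set G :=
  [set alpha + g | g in C].

End Groups.

(* [B] is free of rank [n] over [A] *)
Definition degree_is (R : comNzRingType) (A B : set R) (n : nat) : Prop :=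
  exists e : 'I_n -> R, (forall i, B (e i)) /\
    forall y, B y -> exists! c : {ffun 'I_n -> R},
      (forall i, A (c i)) /\ y = \sum_i c i * e i.

Section Residue.
Variables (F : fieldType) (G : orderedGroupType) (v : valuation F G).

Definition vring : {pred F} := [pred x | Fin 0 <= v x].

Fact vring_subring : subring_closed vring.
Proof.
split=> [|x y xO yO|x y xO yO]; rewrite !inE ?val1 //.
  by apply: val_leD; rewrite ?valN.
by rewrite valM -[0]addr0; apply: ext_leD.
Qed.
HB.instance Definition _ := GRing.isSubringClosed.Build F vring vring_subring.

Record vring_type := VRing { vring_val : F; vring_valP : vring_val \in vring }.
HB.instance Definition _ := [isSub for vring_val].
HB.instance Definition _ := [Choice of vring_type by <:].
HB.instance Definition _ := [SubChoice_isSubComNzRing of vring_type by <:].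

Definition vmax : {pred vring_type} := [pred x | Fin 0 < v (val x)].

Fact vmax_ideal : idealr_closed vmax.
Proof.
split=> [||a x y xm ym]; rewrite !inE ?rmorph0 ?val0 ?Fin_lt //.
  by rewrite rmorph1 val1 ltxx.
rewrite -Fin_lt rmorphD rmorphM; apply: val_ltD => //.
rewrite valM -[0]addr0.
have -> : ext_add (v (val a)) (v (val x)) = ext_add (v (val x)) (v (val a)).
  by case: (v (val a)) (v (val x)) => [|g|] [|h|] //=; rewrite addrC.
by apply: ext_ltD => //; exact: (vring_valP a).
Qed.
HB.instance Definition _ := isIdealr.Build vring_type vmax vmax_ideal.

Definition residue : comNzRingType := {ideal_quot vmax}.

End Residue.

(* The graded ring of a valuation [mu] on [R].  A raw element is a formal sum
   of homogeneous elements (gamma, f) with gamma <= mu f; two formal sums are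
   identified when, for each gamma, their components of degree gamma differ by
   an element of value > gamma. *)
Section GradedRing.
Variables (R : comNzRingType) (G : orderedGroupType) (mu : valuation R G).

Definition homog := {u : G * R | Fin u.1 <= mu u.2}.
Implicit Types (u w : homog) (s t r : seq homog) (c : G).

Definition hmk c f (h : Fin c <= mu f) : homog :=
  exist (fun u : G * R => is_true (Fin u.1 <= mu u.2)) (c, f) h.

Fact hone_subproof : Fin (0 : G) <= mu 1. Proof. by rewrite val1. Qed.
Definition hone : homog := hmk hone_subproof.

Fact hopp_subproof u : Fin (val u).1 <= mu (- (val u).2).
Proof. by rewrite valN (valP u). Qed.
Definition hopp u : homog := hmk (hopp_subproof u).

Fact hmul_subproof u w :
  Fin ((val u).1 + (val w).1) <= mu ((val u).2 * (val w).2).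
Proof. by rewrite valM; exact: ext_leD (valP u) (valP w). Qed.
Definition hmul u w : homog := hmk (hmul_subproof u w).

Definition comp c s : R := \sum_(u <- s | (val u).1 == c) (val u).2.

Definition gr_eqv s t : bool := `[< forall c, Fin c < mu (comp c s - comp c t) >].

Definition gr_oppr s := map hopp s.
Definition gr_mulr s t := [seq hmul u w | u <- s, w <- t].

Lemma gr_eqv_comp s t : (forall c, comp c s = comp c t) -> gr_eqv s t.
Proof. by move=> e; apply/asboolP => c; rewrite e subrr val0 Fin_lt. Qed.

Lemma gr_eqv_refl : reflexive gr_eqv.
Proof. by move=> s; exact: (@gr_eqv_comp s s (fun=> erefl)). Qed.
Lemma gr_eqv_sym : symmetric gr_eqv.
Proof.
by move=> s t; apply/asboolP/asboolP => h c; rewrite -opprB valN; apply: h.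
Qed.
Lemma gr_eqv_trans : transitive gr_eqv.
Proof.
move=> s t r /asboolP ts /asboolP sr; apply/asboolP => c.
rewrite -[comp c t](subrK (comp c s)) -addrA; apply: val_ltD; [exact: ts | exact: sr].
Qed.

Canonical gr_equiv := EquivRel gr_eqv gr_eqv_refl gr_eqv_sym gr_eqv_trans.

Definition graded := {eq_quot gr_eqv}.
HB.instance Definition _ := EqQuotient.on graded.
HB.instance Definition _ := Choice.on graded.

Lemma comp_cat c s t : comp c (s ++ t) = comp c s + comp c t.
Proof. by rewrite /comp big_cat. Qed.
Lemma comp_opp c s : comp c (gr_oppr s) = - comp c s.
Proof. by rewrite /comp big_map sumrN. Qed.
Lemma comp_mul c s t :
  comp c (gr_mulr s t) = \sum_(w <- t) comp (c - (val w).1) s * (val w).2.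
Proof.
rewrite /comp /gr_mulr big_mkcond big_allpairs_dep exchange_big /=.
apply: eq_bigr => w _; rewrite mulr_suml [RHS]big_mkcond.
by apply: eq_bigr => u _; rewrite eq_sym -subr_eq eq_sym; case: ifP; rewrite ?mul0r.
Qed.
Lemma comp_mulC c s t : comp c (gr_mulr s t) = comp c (gr_mulr t s).
Proof.
rewrite /comp /gr_mulr big_mkcond [RHS]big_mkcond !big_allpairs_dep exchange_big /=.
by apply: eq_bigr => w _; apply: eq_bigr => u _; rewrite addrC mulrC.
Qed.

Lemma gr_eqv_mull s s' t : gr_eqv s s' -> gr_eqv (gr_mulr s t) (gr_mulr s' t).
Proof.
move=> /asboolP h; apply/asboolP => c; rewrite !comp_mul -sumrB.
apply: val_lt_sum => w _; rewrite -mulrBl valM -[X in Fin X](subrK (val w).1).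
by apply: ext_ltD => //; exact: (valP w).
Qed.

Lemma gr_eqv_mulr s t t' : gr_eqv t t' -> gr_eqv (gr_mulr s t) (gr_mulr s t').
Proof.
move=> h; have e : gr_eqv (gr_mulr t' s) (gr_mulr s t').
  by apply: gr_eqv_comp => c; apply: comp_mulC.
apply: gr_eqv_trans e.
apply: gr_eqv_trans (gr_eqv_mull s h); by apply: gr_eqv_comp => c; apply: comp_mulC.
Qed.

Definition gr_zero : graded := lift_cst graded [::].
Definition gr_one : graded := lift_cst graded [:: hone].
Definition gr_opp := lift_op1 graded gr_oppr.
Definition gr_add := lift_op2 graded (@cat homog).
Definition gr_mul := lift_op2 graded gr_mulr.

Canonical pi_gr_zero := PiConst gr_zero.
Canonical pi_gr_one := PiConst gr_one.

Lemma reprP s : gr_eqv (repr (\pi_graded s)) s.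
Proof. by apply/eqmodP; rewrite reprK. Qed.

Lemma pi_gr_opp : {morph \pi_graded : s / gr_oppr s >-> gr_opp s}.
Proof.
move=> s; unlock gr_opp; apply/eqmodP/asboolP => c.
rewrite !comp_opp -opprD valN.
by have /asboolP/(_ c) := reprP s; rewrite -opprB valN.
Qed.
Canonical pi_gr_opp_morph := PiMorph1 pi_gr_opp.

Lemma pi_gr_add : {morph \pi_graded : s t / s ++ t >-> gr_add s t}.
Proof.
move=> s t; unlock gr_add; apply/eqmodP/asboolP => c.
rewrite !comp_cat -opprB valN.
have /asboolP/(_ c) hs := reprP s; have /asboolP/(_ c) ht := reprP t.
by rewrite opprD addrACA; apply: val_ltD.
Qed.
Canonical pi_gr_add_morph := PiMorph2 pi_gr_add.

Lemma pi_gr_mul : {morph \pi_graded : s t / gr_mulr s t >-> gr_mul s t}.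
Proof.
move=> s t; unlock gr_mul; apply/eqmodP.
rewrite /= gr_eqv_sym; apply: gr_eqv_trans (gr_eqv_mull _ (reprP s)).
exact: gr_eqv_mulr (reprP t).
Qed.
Canonical pi_gr_mul_morph := PiMorph2 pi_gr_mul.

Lemma gr_addA : associative gr_add.
Proof. by move=> x y z; rewrite -[x]reprK -[y]reprK -[z]reprK !piE catA. Qed.
Lemma gr_addC : commutative gr_add.
Proof.
move=> x y; rewrite -[x]reprK -[y]reprK !piE.
by apply/eqmodP/gr_eqv_comp => c; rewrite !comp_cat addrC.
Qed.
Lemma gr_add0 : left_id gr_zero gr_add.
Proof. by move=> x; rewrite -[x]reprK !piE. Qed.
Lemma gr_addN : left_inverse gr_zero gr_opp gr_add.
Proof.
move=> x; rewrite -[x]reprK !piE; apply/eqmodP/gr_eqv_comp => c.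
by rewrite comp_cat comp_opp addNr /comp big_nil.
Qed.
HB.instance Definition _ :=
  GRing.isZmodule.Build graded gr_addA gr_addC gr_add0 gr_addN.

Lemma gr_mulA : associative gr_mul.
Proof.
move=> x y z; rewrite -[x]reprK -[y]reprK -[z]reprK !piE; congr (\pi _).
rewrite /gr_mulr; elim: (repr x) => //= u s ->.
rewrite allpairs_cat map_allpairs allpairs_mapl; congr cat.
apply: eq_allpairs => // w a.
by apply: val_inj; rewrite /= addrA mulrA.
Qed.
Lemma gr_mulC : commutative gr_mul.
Proof.
move=> x y; rewrite -[x]reprK -[y]reprK !piE.
by apply/eqmodP/gr_eqv_comp => c; apply: comp_mulC.
Qed.
Lemma gr_mul1 : left_id gr_one gr_mul.
Proof.
move=> x; rewrite -[x]reprK !piE; congr (\pi _).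
rewrite /gr_mulr /= cats0 -[RHS]map_id; apply: eq_map => u.
by apply: val_inj; rewrite /= add0r mul1r -surjective_pairing.
Qed.
Lemma gr_mulDl : left_distributive gr_mul gr_add.
Proof.
move=> x y z; rewrite -[x]reprK -[y]reprK -[z]reprK !piE.
by rewrite /gr_mulr allpairs_cat.
Qed.
Lemma gr_oner_neq0 : gr_one != gr_zero.
Proof.
apply/negP; rewrite !piE => /asboolP/(_ 0).
by rewrite /comp big_nil big_cons big_nil /= eqxx addr0 subr0 val1 ltxx.
Qed.
HB.instance Definition _ := GRing.Zmodule_isComNzRing.Build graded
  gr_mulA gr_mulC gr_mul1 gr_mulDl gr_oner_neq0.

(* The initial form, with in(f) = 0 when f has infinite value. *)
Definition gr_in (f : R) : graded :=
  if mu f is Fin c then oapp (fun u => \pi_graded [:: u]) 0 (insub (c, f))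
  else 0.

End GradedRing.

Section Defect.
Variables (K : fieldType) (L : fieldExtType K) (G : orderedGroupType).
Variables (v : valuation L G).
Variables (Omega : closedFieldType) (j : {rmorphism L -> Omega}).

Local Notation vK := (comap (in_alg L) v).

(* the image of Kv in Lv *)
Definition residue_sub : set (residue v) :=
  [set y | exists2 x : vring_type v, (exists b : K, val x = b%:A) & y = \pi x].

Definition subfield_set (E : set Omega) : Prop :=
  [/\ E 1, forall x y, E x -> E y -> E (x - y)
         & forall x y, E x -> E y -> E (x / y)].

(* Omega being algebraic over E, all extensions of w|E to Omega have, up to
   equivalence, their values in the divisible group G. *)
Definition henselian (w : valuation Omega G) (E : set Omega) : Prop :=
  forall w' : valuation Omega G,
    (forall x, E x -> w' x = w x) -> forall x, w' x = w x.

(* [H] is the henselization of [(E, w)] inside [(Omega, w)]. *)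
Definition is_henselization (w : valuation Omega G) (E H : set Omega) : Prop :=
  [/\ subfield_set H, E `<=` H, henselian w H
    & forall H', subfield_set H' -> E `<=` H' -> henselian w H' -> H `<=` H'].

Definition defect_is (d : nat) : Prop :=
  exists (w : valuation Omega G) (Kh Lh : set Omega) (n e f : nat),
    [/\ forall x, w (j x) = v x,
        is_henselization w (range (j \o in_alg L)) Kh
          /\ is_henselization w (range j) Lh,
        degree_is Kh Lh n,
        index_is (value_group vK) (value_group v) e
          /\ degree_is residue_sub setT f
      & n = (d * e * f)%N].

End Defect.

Section KeyPolynomials.
Variables (K : fieldType) (G : orderedGroupType) (nu : valuation {poly K} G).
Variables (Kbar : closedFieldType) (iota : {rmorphism K -> Kbar}).
Variables (nubar : valuation {poly Kbar} G).
Implicit Types (f F Q : {poly K}) (n : nat).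

Definition roots_in f : seq Kbar :=
  sval (closed_field_poly_normal (map_poly iota f)).

Definition epsilon f : ext G :=
  \big[Order.max/NInf]_(b <- roots_in f) nubar ('X - b%:P).

Definition key_poly Q : Prop :=
  [/\ Q \is monic, (1 < size Q)%N
    & forall f, f != 0 -> (size f < size Q)%N -> epsilon f < epsilon Q].

Definition Psi n : set {poly K} := [set Q | key_poly Q /\ size Q = n.+1].

Definition has_no_max n : Prop :=
  ~ exists2 Q, Psi n Q & forall Q', Psi n Q' -> nu Q' <= nu Q.

Definition bounded_in n : Prop :=
  exists c : G, forall Q, Psi n Q -> nu Q <= Fin c.

Definition key_poly_for n F : Prop :=
  [/\ key_poly F, (n.+1 < size F)%N
    & forall F', key_poly F' -> (n.+1 < size F')%N -> (size F <= size F')%N].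

Definition plateau n : Prop := (exists Q, Psi n Q) /\ has_no_max n.

Definition limit_key_poly n F : Prop := plateau n /\ key_poly_for n F.

(* The coefficient a_{Qi}(f) of the Q-expansion of f; see [qcoefE] and
   [qcoef_unique] below. *)
Definition qcoef Q f (i : nat) : {poly K} := (f %/ Q ^+ i) %% Q.

(* For Q of positive degree all nonzero a_{Qi}(f) have i < size f. *)
Definition nuQ Q f : ext G :=
  \big[Order.min/PInf]_(i < size f | qcoef Q f i != 0) nu (qcoef Q f i * Q ^+ i).

(* R_Q, as the additive subgroup generated by the in(f) with deg f < deg Q *)
Definition coef_ring (mu : valuation {poly K} G) Q : set (graded mu) :=
  [set x | forall S : set (graded mu), subgroup S ->
     (forall f, (size f < size Q)%N -> S (gr_in mu f)) -> S x].

(* deg_Q(f) = d : the initial form of f in the graded ring of nu_Q is a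
   polynomial of degree d in y_Q with coefficients in R_Q.  That nu_Q is a
   valuation is part of the relation. *)
Definition degQ_is Q f (d : nat) : Prop :=
  exists mu : valuation {poly K} G, (forall h, mu h = nuQ Q h) /\
  exists P : {poly graded mu},
    [/\ forall i, coef_ring Q P`_i, P.[gr_in mu Q] = gr_in mu f
      & size P = d.+1].

Definition eventually n (P : {poly K} -> Prop) : Prop :=
  exists2 Q0, Psi n Q0 & forall Q, Psi n Q -> nu Q0 <= nu Q -> P Q.

Definition plateau_defect_is n (d : nat) : Prop :=
  (exists F, limit_key_poly n F) /\
  forall F, limit_key_poly n F -> eventually n (fun Q => degQ_is Q F d).

Section PlateauSet.
Variables (p n r : nat).

Definition plateau_set_prop (I : {set 'I_r}) : Prop :=
  forall F, limit_key_poly n F -> eventually n (fun Q =>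
    (forall i : 'I_r, i \in I -> qcoef Q F (p ^ i) != 0) /\
    limit_key_poly n
      (qcoef Q F 0 + \sum_(i in I) qcoef Q F (p ^ i) * Q ^+ (p ^ i)
       + Q ^+ (p ^ r))).

(* The least set with the property above. When there is only one such set
   this is that set; but for Kummer extensions of degree 2, say, every limit
   key polynomial F is quadratic, so that {0} always has the property (F is
   its own truncation and a_{Q1}(F) eventually does not vanish), whether or
   not the empty set has it. *)
Definition is_plateau_set (I : {set 'I_r}) : Prop :=
  plateau_set_prop I /\ forall J, plateau_set_prop J -> I \subset J.

End PlateauSet.

Section QExpansion.
Variable Q : {poly K}.
Hypotheses (Qm : Q \is monic) (Qgt1 : (1 < size Q)%N).

Lemma qcoef_size f i : (size (qcoef Q f i) < size Q)%N.
Proof. by rewrite ltn_modp monic_neq0. Qed.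

Lemma div_exp_small f i : (size f <= i)%N -> f %/ Q ^+ i = 0.
Proof.
move=> fi; apply: divp_small; apply: leq_ltn_trans fi _.
have Qi0 : (0 < size (Q ^+ i)%R)%N by rewrite size_poly_gt0 expf_neq0 ?monic_neq0.
by rewrite -(ltn_predK Qi0) size_exp ltnS leq_pmull // -ltnS (ltn_predK Qgt1).
Qed.

Lemma qcoef_eq0 f i : (size f <= i)%N -> qcoef Q f i = 0.
Proof. by move=> fi; rewrite /qcoef div_exp_small // mod0p. Qed.

Lemma qcoefE f : f = \sum_(i < size f) qcoef Q f i * Q ^+ i.
Proof.
have part m : f = \sum_(i < m) qcoef Q f i * Q ^+ i + (f %/ Q ^+ m) * Q ^+ m.
  elim: m => [|m IH]; first by rewrite big_ord0 add0r expr0 divp1 mulr1.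
  rewrite {1}IH big_ord_recr /= -addrA; congr (_ + _).
  rewrite {1}(divp_eq (f %/ Q ^+ m) Q) divp_divl -exprSr.
  by rewrite mulrDl addrC -mulrA -exprS.
by rewrite {1}(part (size f)) div_exp_small // mul0r addr0.
Qed.

Lemma qcoef_unique f (m : nat) (a : nat -> {poly K}) :
  (forall i, size (a i) < size Q)%N -> f = \sum_(i < m) a i * Q ^+ i ->
  forall i, (i < m)%N -> a i = qcoef Q f i.
Proof.
have Q0 : Q != 0 by rewrite monic_neq0.
elim: m f a => [//|m IH] f a sa; rewrite big_ord_recl expr0 mulr1 => ef.
have e : f = (\sum_(i < m) a i.+1 * Q ^+ i) * Q + a 0%N.
  rewrite ef addrC; congr (_ + _); rewrite mulr_suml; apply: eq_bigr => i _.
  by rewrite exprSr mulrA.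
have fd : f %/ Q = \sum_(i < m) a i.+1 * Q ^+ i.
  by rewrite e divpD mulpK // [a 0%N %/ _]divp_small ?addr0.
case=> [_|i im]; first by rewrite /qcoef expr0 divp1 e modpD modp_mull add0r modp_small.
rewrite (IH _ (fun i => a i.+1) (fun i => sa i.+1) fd i im) /qcoef.
by rewrite divp_divl -exprS.
Qed.

End QExpansion.

End KeyPolynomials.

Section Extensions.
Variables (K : fieldType) (L : fieldExtType K) (G : orderedGroupType).
Variables (v : valuation L G) (p : nat) (eta : L) (a : K).

(* nu(f) = v(f(eta)) *)
Definition nu_of : valuation {poly K} G := comap (horner_alg eta) v.

Definition artin_schreier : Prop :=
  [/\ p \in [pchar K], <<1; eta>>%VS = {:L}%VS
    & minPoly 1 eta = map_poly (in_alg L) ('X^p - 'X - a%:P)].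

Definition kummer : Prop :=
  [/\ exists z : K, p.-primitive_root z, <<1; eta>>%VS = {:L}%VS
    & minPoly 1 eta = map_poly (in_alg L) ('X^p - a%:P)].

Definition dist_to_base : set G :=
  cut_up [set v (eta - b%:A) | b in [set: K]].

Definition convex_minus (H : set G) : set G := cut_minus [set Fin h | h in H].

Definition independent : Prop :=
  (artin_schreier /\ exists2 H : set G, convex_subgroup setT H
     & dist_to_base = convex_minus H) \/
  (kummer /\ exists alpha : G, Fin (alpha *+ p.-1) = v p%:R /\
     exists2 H : set G, convex_subgroup setT H
     & dist_to_base = cut_shift alpha (convex_minus H)).

Definition dependent : Prop := ~ independent.

End Extensions.

(* Main.v *)
(** Let D be the cut of the values v(eta - b), b in K. The defect p equals
    [L^h : K^h] <= p, so the extension is immediate and D is not attained; eta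
    has another conjugate over K^h, at the same distance from every b, so D is
    bounded. Call c in the algebraic closure close if v(eta - c) > D. A Newton
    step shows that the number of close roots of a polynomial over K is 0 or
    not prime to p. So there are none in degree < p, and in degree p all roots
    are close or none is: the key polynomials are the x - b and the monic F of
    degree p with v(F(eta)) > p D.

    In the Taylor expansion at eta of such an F, the terms of degree 2 to p - 1
    have value > p D near D, because the roots of F' are not close. Hence
    F(b) + (x - b)^p is a limit key polynomial for b near eta if and only if
    v(F'(eta)) > (p - 1) D, while adding F'(b) (x - b) always gives one. Since
    v(F'(eta) - g'(eta)) > (p - 1) D, the condition does not depend on F, and
    v(g'(eta)) = (p - 1) D says precisely that the extension is independent. *)

From HB Require Import structures.
Require Import Defs.
From mathcomp Require Import all_boot all_order all_algebra all_field.
From mathcomp Require Import boolp classical_sets ring.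
Import Order.TTheory GRing.Theory Num.Theory.
Local Open Scope ring_scope.
Set Implicit Arguments.
Unset Strict Implicit.
Unset Printing Implicit Defensive.

(** Two valuations on the algebraic closure occur and are never compared. The [w0] that comes with
    the henselizations serves only to show that the extension is immediate and that D is bounded.
    The other one, [w], is [nubar] on constants: as [nubar] is infinite on g, it is evaluation at
    some root y of g, not necessarily [j eta], followed by [w]. Of the extension only the equality
    w(y - b) = v(eta - b) for b in K is then needed, and the central part works with these values
    [cv b].

    Rank one makes the estimates possible. A bounded cut in an archimedean group is approached up to
    any positive t: some [cv b] has all of D below it plus t. Each strict gain, from a far root or
    from a factor of positive value, is spent as such a t.

    The threshold (p - 1) D comes from g'(eta), which is -1 for Artin-Schreier and p eta^(p - 1)
    with v(eta) = 0 for Kummer. Equality thus means that D is 0^- or v(p)/(p - 1) + 0^-, and H = 0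
    is the only subgroup that can occur in the definition of independence. *)

Section OrderedGroup.
Variable G : orderedGroupType.
Implicit Types g h k : G.

Lemma og_ltNge g h : (g < h) = ~~ (h <= g).
Proof.
have [gh|hg] := orP (og_le_total g h); last first.
  by rewrite hg; apply/negbTE/negP => /lt_le_trans/(_ hg); rewrite ltxx.
rewrite lt_neqAle gh andbT; congr negb; apply/eqP/idP => [->//|hg].
by apply: le_anti; rewrite gh.
Qed.

Lemma og_leNgt g h : (g <= h) = ~~ (h < g).
Proof. by rewrite og_ltNge negbK. Qed.

Lemma og_le2l g h k : (g + h <= g + k) = (h <= k).
Proof.
apply/idP/idP; last exact: og_leD2l.
by rewrite !og_leNgt; apply: contra; apply: og_ltD2l.
Qed.

Lemma og_lt2l g h k : (g + h < g + k) = (h < k).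
Proof. by rewrite !og_ltNge og_le2l. Qed.

Lemma og_le2r g h k : (h + g <= k + g) = (h <= k).
Proof. by rewrite ![_ + g]addrC og_le2l. Qed.

Lemma og_lt2r g h k : (h + g < k + g) = (h < k).
Proof. by rewrite ![_ + g]addrC og_lt2l. Qed.

Lemma og_subr_gt0 g h : (0 < h - g) = (g < h).
Proof. by rewrite -(og_lt2r g 0) add0r subrK. Qed.

Lemma og_le_ltD g h k l : g <= k -> h < l -> g + h < k + l.
Proof. by move=> gk hl; apply: (@lt_le_trans _ _ (g + l)); rewrite ?og_lt2l ?og_le2r. Qed.

Lemma og_lt_leD g h k l : g < k -> h <= l -> g + h < k + l.
Proof. by move=> gk hl; rewrite addrC [k + l]addrC og_le_ltD. Qed.

Lemma og_le_MnW n g h : g <= h -> g *+ n <= h *+ n.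
Proof. by move=> gh; elim: n => // n IH; rewrite !mulrS og_leD. Qed.

Lemma og_lt_Mn n g h : (0 < n)%N -> (g *+ n < h *+ n) = (g < h).
Proof.
case: n => // n _; apply/idP/idP; last first.
  by move=> gh; rewrite !mulrS og_lt_leD // og_le_MnW ?ltW.
by rewrite !og_ltNge; apply: contra; apply: og_le_MnW.
Qed.

Lemma og_le_Mn n g h : (0 < n)%N -> (g *+ n <= h *+ n) = (g <= h).
Proof. by move=> n0; rewrite !og_leNgt og_lt_Mn. Qed.

Lemma Fin_le g h : (Fin g <= Fin h) = (g <= h). Proof. by []. Qed.

Lemma Fin_ltE g h : (Fin g < Fin h) = (g < h). Proof. by rewrite Fin_lt. Qed.

Lemma le_PInf (x : ext G) : x <= PInf. Proof. by case: x. Qed.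

Lemma PInf_le (x : ext G) : (PInf <= x) = (x == PInf).
Proof. by rewrite eq_le le_PInf. Qed.

Lemma NInf_le (x : ext G) : NInf <= x. Proof. by case: x. Qed.

End OrderedGroup.

(** * Valuations on rings and fields *)

Section RingValuation.
Variables (R : comNzRingType) (G : orderedGroupType) (w : valuation R G).
Implicit Types x y : R.

Lemma valB x y : w (x - y) = w (y - x).
Proof. by rewrite -opprB valN. Qed.

Lemma valDl x y : w x < w y -> w (x + y) = w x.
Proof.
move=> xy; apply: le_anti; rewrite (val_leD (lexx _) (ltW xy)) andbT leNgt.
apply/negP => h; have : w x < w (x + y - y) by apply: val_ltD; rewrite ?valN.
by rewrite addrK ltxx.
Qed.

Lemma valDr x y : w y < w x -> w (x + y) = w y.
Proof. by rewrite addrC; apply: valDl. Qed.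

Lemma val_sum_ge (I : eqType) (s : seq I) (P : pred I) (f : I -> R) (g : ext G) :
  (forall i, i \in s -> P i -> g <= w (f i)) -> g <= w (\sum_(i <- s | P i) f i).
Proof.
move=> h; rewrite big_seq_cond; apply: (big_ind (fun x => g <= w x)).
- by rewrite val0 le_PInf.
- by move=> x y; apply: val_leD.
- by move=> i /andP[]; apply: h.
Qed.

Lemma val_sum_gt (I : eqType) (s : seq I) (P : pred I) (f : I -> R) (g : G) :
  (forall i, i \in s -> P i -> Fin g < w (f i)) -> Fin g < w (\sum_(i <- s | P i) f i).
Proof.
by move=> h; rewrite big_seq_cond; apply: val_lt_sum => i /andP[]; apply: h.
Qed.

Lemma val_nat_ge0 n : Fin 0 <= w n%:R.
Proof.
elim: n => [|n IH]; first by rewrite val0 le_PInf.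
by rewrite -addn1 natrD; apply: val_leD; rewrite ?Defs.val1.
Qed.

End RingValuation.

Section FieldValuation.
Variables (F : fieldType) (G : orderedGroupType) (w : valuation F G).
Implicit Types x y z : F.

Lemma ext_addC (x y : ext G) : ext_add x y = ext_add y x.
Proof. by case: x y => [|g|] [|h|] //=; rewrite addrC. Qed.

Lemma val_Fin x : x != 0 -> exists g, w x = Fin g.
Proof.
move=> x0; have := Defs.valM w x x^-1; rewrite divff // Defs.val1.
have := @val_nNInf _ _ w x; have := @val_nNInf _ _ w x^-1.
by case: (w x) => [|g|] //; [exists g|case: (w _)].
Qed.

Lemma val_PInf x : (w x == PInf) = (x == 0).
Proof.
apply/eqP/eqP => [wx|->]; last exact: val0.
by apply/eqP/negPn/negP => /val_Fin[g]; rewrite wx.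
Qed.

Lemma val_le2r z x y : z != 0 -> (w (x * z) <= w (y * z)) = (w x <= w y).
Proof.
move=> /val_Fin[g wz]; rewrite !Defs.valM wz !ext_leE.
have := @val_nNInf _ _ w x; have := @val_nNInf _ _ w y.
by case: (w x) (w y) => [|h|] [|k|] //= _ _; rewrite og_le2r.
Qed.

Lemma val_lt2r z x y : z != 0 -> (w (x * z) < w (y * z)) = (w x < w y).
Proof. by move=> z0; rewrite !ltNge val_le2r. Qed.

Lemma val_le2l z x y : z != 0 -> (w (z * x) <= w (z * y)) = (w x <= w y).
Proof. by move=> z0; rewrite ![z * _]mulrC val_le2r. Qed.

Lemma val_lt2l z x y : z != 0 -> (w (z * x) < w (z * y)) = (w x < w y).
Proof. by move=> z0; rewrite ![z * _]mulrC val_lt2r. Qed.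

Lemma val_leM x y z t : w x <= w y -> w z <= w t -> w (x * z) <= w (y * t).
Proof.
move=> xy zt; have [->|t0] := eqVneq t 0; first by rewrite mulr0 val0 le_PInf.
have [->|x0] := eqVneq y 0; first by rewrite mul0r val0 le_PInf.
by apply: (@le_trans _ _ (w (y * z))); rewrite ?val_le2l //; rewrite !Defs.valM;
   move: xy; rewrite !ext_leE; case: (w x) (w y) (w z) => [|?|] [|?|] [|?|] //=;
   rewrite og_le2r.
Qed.

Lemma val_lt_leM x y z t : w x < w y -> w z <= w t -> z != 0 -> w (x * z) < w (y * t).
Proof.
move=> xy zt z0; apply: (@lt_le_trans _ _ (w (y * z))); first by rewrite val_lt2r.
exact: val_leM.
Qed.

Lemma valMl1 x y : w x = w 1 -> w (x * y) = w y.
Proof. by rewrite Defs.valM Defs.val1 => ->; case: (w y) (@val_nNInf _ _ w y) => //= g _; rewrite add0r. Qed.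

Lemma val_congM x y z t : w x = w y -> w z = w t -> w (x * z) = w (y * t).
Proof. by rewrite !Defs.valM => -> ->. Qed.

Lemma valX x y n : w x = w y -> w (x ^+ n) = w (y ^+ n).
Proof. by move=> xy; elim: n => // n IH; rewrite !exprS; apply: val_congM. Qed.

Lemma val_FinX x g n : w x = Fin g -> w (x ^+ n) = Fin (g *+ n).
Proof.
by move=> xg; elim: n => [|n IH]; rewrite ?Defs.val1 ?mulr0n // exprS mulrS Defs.valM xg IH.
Qed.

Lemma val_leX x y n : w x <= w y -> w (x ^+ n) <= w (y ^+ n).
Proof. by move=> xy; elim: n => // n IH; rewrite !exprS; apply: val_leM. Qed.

End FieldValuation.

(** * Taylor shifts and scaling of the variable *)

Section Shift.
Variables (R : comNzRingType).
Implicit Types (P : {poly R}) (x : R).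

Lemma shift0 P x : (P \Po ('X + x%:P))`_0 = P.[x].
Proof. by rewrite -horner_coef0 horner_comp hornerD hornerX hornerC add0r. Qed.

Lemma deriv_shift P x : (P \Po ('X + x%:P))^`() = P^`() \Po ('X + x%:P).
Proof. by rewrite deriv_comp derivD derivX derivC addr0 mulr1. Qed.

Lemma shift1 P x : (P \Po ('X + x%:P))`_1 = P^`().[x].
Proof. by rewrite -shift0 -deriv_shift coef_deriv mulr1n. Qed.

Lemma coef_comp_scaleX P x i : (P \Po (x *: 'X))`_i = P`_i * x ^+ i.
Proof.
rewrite comp_polyE coef_sum; have [iP|iP] := ltnP i (size P).
  rewrite (bigD1 (Ordinal iP)) //= big1 ?addr0 => [|k ki].
    by rewrite coefZ exprZn coefZ coefXn eqxx mulr1.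
  rewrite coefZ exprZn coefZ coefXn; case: eqP => [ik|_]; rewrite ?mulr0 //.
  by case/eqP: ki; apply: val_inj.
rewrite nth_default // mul0r big1 // => k _.
rewrite coefZ exprZn coefZ coefXn; case: eqP => [ik|_]; rewrite ?mulr0 //.
by have := ltn_ord k; rewrite -ik ltnNge iP.
Qed.

End Shift.

(** * Homogeneous components in the graded ring *)

Section GradedTheory.
Variables (R : comNzRingType) (G : orderedGroupType) (mu : valuation R G).
Implicit Types (f h : R) (c d : G).
Local Open Scope quotient_scope.

(** The initial form takes its degree from f and is not additive. With the degree c prescribed, the
    component is additive on elements of value at least c and vanishes on those of larger value;
    [insub] gives 0 when the value of f is below c. *)
Definition gr_part c f : graded mu :=
  oapp (fun u : homog mu => \pi_(graded mu) [:: u]) 0 (insub (c, f)).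

Lemma gr_partE c f (le : Fin c <= mu f) : gr_part c f = \pi_(graded mu) [:: hmk le].
Proof. by rewrite /gr_part; case: insubP => [u _ eu|]; [congr (\pi [:: _]); apply: val_inj|rewrite le]. Qed.

Lemma gr_inE f c : mu f = Fin c -> gr_in mu f = gr_part c f.
Proof. by rewrite /gr_in => ->. Qed.

Lemma comp1 c (u : homog mu) : Defs.comp c [:: u] = if (val u).1 == c then (val u).2 else 0.
Proof. by rewrite /Defs.comp big_cons big_nil; case: ifP; rewrite ?addr0. Qed.

Lemma gr_part0 c f : Fin c < mu f -> gr_part c f = 0.
Proof.
move=> lt; rewrite (gr_partE (ltW lt)) -[0]/(gr_zero mu) piE; apply/eqmodP/asboolP => d.
rewrite comp1 /Defs.comp big_nil subr0 /=; case: eqP => [<-//|_].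
by rewrite Defs.val0 Fin_lt.
Qed.

Lemma gr_partD c f h : Fin c <= mu f -> Fin c <= mu h ->
  gr_part c (f + h) = gr_part c f + gr_part c h.
Proof.
move=> lf lh; rewrite (gr_partE lf) (gr_partE lh) (gr_partE (val_leD lf lh)).
rewrite -[X in _ = X]/(gr_add _ _) piE; apply/eqmodP/gr_eqv_comp => d.
by rewrite comp_cat !comp1 /=; case: eqP; rewrite ?addr0.
Qed.

Lemma gr_partM c d f h : Fin c <= mu f -> Fin d <= mu h ->
  gr_part c f * gr_part d h = gr_part (c + d) (f * h).
Proof.
move=> lf lh; have lfh : Fin (c + d) <= mu (f * h) by rewrite Defs.valM; apply: ext_leD.
rewrite (gr_partE lf) (gr_partE lh) (gr_partE lfh).
rewrite -[X in X = _]/(gr_mul _ _) piE; apply/eqmodP/gr_eqv_comp => e.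
by rewrite /= !comp1.
Qed.

Lemma gr_part_sum (I : eqType) (s : seq I) (F : I -> R) c :
  (forall i, i \in s -> Fin c <= mu (F i)) ->
  gr_part c (\sum_(i <- s) F i) = \sum_(i <- s) gr_part c (F i).
Proof.
elim: s => [|i s IH] h; first by rewrite !big_nil gr_part0 // Defs.val0 Fin_lt.
have hs j : j \in s -> Fin c <= mu (F j) by move=> js; apply: h; rewrite inE js orbT.
rewrite !big_cons gr_partD ?h ?mem_head ?IH // big_seq.
by apply: (big_ind (fun x => Fin c <= mu x)) => [|x y|//]; [rewrite Defs.val0 le_PInf|apply: val_leD].
Qed.

Lemma gr_part1 : gr_part 0 1 = 1.
Proof.
rewrite (gr_partE (hone_subproof mu)) -[RHS]/(gr_one mu) piE.
by apply/eqmodP/gr_eqv_comp => d; rewrite !comp1.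
Qed.

Lemma gr_partX c f n : Fin c <= mu f -> gr_part c f ^+ n = gr_part (c *+ n) (f ^+ n).
Proof.
move=> lf; have lfn m : Fin (c *+ m) <= mu (f ^+ m).
  by elim: m => [|m IH]; rewrite ?Defs.val1 // exprS mulrS Defs.valM; apply: ext_leD.
by elim: n => [|n IH]; rewrite ?gr_part1 // !exprS mulrS IH gr_partM.
Qed.

End GradedTheory.

(** * The Gauss valuation *)

Section GaussValuation.
Variables (F : fieldType) (G : orderedGroupType) (w : valuation F G).
Implicit Types P Q : {poly F}.

Definition gauss P : ext G := \big[Order.min/PInf]_(i < size P) w P`_i.

Lemma le_gauss P x : reflect (forall i, x <= w P`_i) (x <= gauss P).
Proof.
apply: (iffP idP) => [h i|h]; last by apply: le_bigmin; rewrite ?le_PInf.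
have [ip|ip] := ltnP i (size P); last by rewrite nth_default // Defs.val0 le_PInf.
by apply: le_trans h _; exact: (bigmin_le _ (Ordinal ip) (fun i => w P`_i)).
Qed.

Lemma gauss_le P i : gauss P <= w P`_i.
Proof. exact/le_gauss. Qed.

(** The least index of minimal value is what multiplicativity needs: in a product, the coefficient
    at the sum of two such indices has exactly one term of minimal value. *)
Lemma gaussP P : P != 0 -> exists i, [/\ P`_i != 0, gauss P = w P`_i &
  forall j, (j < i)%N -> w P`_i < w P`_j].
Proof.
move=> P0; have ex : exists i, w P`_i == gauss P.
  apply: contrapT => nex.
  have lt i : gauss P < w P`_i.
    rewrite lt_neqAle gauss_le andbT; apply/negP => /eqP e.
    by apply: nex; exists i; rewrite e.
  suff : gauss P < gauss P by rewrite ltxx.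
  rewrite {2}/gauss; apply: lt_bigmin => //; apply: lt_le_trans (lt 0%N) (le_PInf _).
case: (ex_minnP ex) => i /eqP wi mi; exists i; rewrite wi; split=> //; last first.
  move=> j ji; rewrite lt_neqAle gauss_le andbT eq_sym.
  by apply/negP => /mi; rewrite leqNgt ji.
rewrite -(val_PInf w) wi; apply: contraNneq P0 => e; apply/eqP/polyP => j.
by apply/eqP; rewrite coef0 -(val_PInf w) -PInf_le -e gauss_le.
Qed.

Fact gauss0 : gauss 0 = PInf.
Proof. by rewrite /gauss size_poly0 big_ord0. Qed.

Fact gauss1 : gauss 1 = Fin 0.
Proof.
have [i []] := gaussP (oner_neq0 {poly F}); rewrite coef1; case: i => [|i]; rewrite ?eqxx //.
by move=> _ ->; rewrite Defs.val1.
Qed.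

Fact gaussM P Q : gauss (P * Q) = ext_add (gauss P) (gauss Q).
Proof.
have gn R : gauss R <> NInf.
  by have [->|/gaussP[i [_ -> _]]] := eqVneq R 0; [rewrite gauss0|exact: val_nNInf].
have [->|P0] := eqVneq P 0; first by rewrite mul0r gauss0; case: (gauss Q) (gn Q).
have [->|Q0] := eqVneq Q 0; first by rewrite mulr0 gauss0; case: (gauss P) (gn P).
have [i [Pi0 eP ltP]] := gaussP P0; have [j [Qj0 eQ ltQ]] := gaussP Q0.
have leP k : w P`_i <= w P`_k by rewrite -eP gauss_le.
have leQ k : w Q`_j <= w Q`_k by rewrite -eQ gauss_le.
rewrite eP eQ -Defs.valM; apply: le_anti; apply/andP; split; last first.
  apply/le_gauss => k; rewrite coefM; apply: val_sum_ge => l _ _; exact: val_leM.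
apply: le_trans (gauss_le _ (i + j)) _; rewrite coefM.
have ij : (i < (i + j).+1)%N by rewrite ltnS leq_addr.
rewrite (bigD1 (Ordinal ij)) //= addKn.
have [g wg] := val_Fin w (mulf_neq0 Pi0 Qj0); rewrite valDl //.
rewrite wg; apply: val_sum_gt => k _; rewrite -wg -val_eqE /= => ki.
have [kl|kl|ke] := ltngtP k i; last by rewrite ke eqxx in ki.
  by apply: val_lt_leM => //; exact: ltP.
rewrite [P`_i * _]mulrC [P`_k * _]mulrC; apply: val_lt_leM => //; apply: ltQ.
by rewrite ltn_subLR ?ltn_add2r // -ltnS ltn_ord.
Qed.

Fact gaussD P Q : Order.min (gauss P) (gauss Q) <= gauss (P + Q).
Proof.
apply/le_gauss => i; rewrite coefD; apply: le_trans (Defs.valD w _ _).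
by rewrite le_min !ge_min !gauss_le orbT.
Qed.

Fact gauss_nNInf P : gauss P <> NInf.
Proof.
have [->|/gaussP[i [_ -> _]]] := eqVneq P 0; [by rewrite gauss0|exact: val_nNInf].
Qed.

Definition gauss_val : valuation {poly F} G :=
  Valuation gauss0 gauss1 gaussM gaussD gauss_nNInf.

Lemma gaussZXn c n : gauss (c *: 'X^n) = w c.
Proof.
apply: le_anti; apply/andP; split.
  by apply: le_trans (gauss_le _ n) _; rewrite coefZ coefXn eqxx mulr1.
apply/le_gauss => i; rewrite coefZ coefXn; case: eqP => _; rewrite ?mulr1 //.
by rewrite mulr0 Defs.val0 le_PInf.
Qed.

End GaussValuation.

Lemma prod_XsubC_logderiv (F : fieldType) (s : seq F) (x : F) : x \notin s ->
  (\prod_(c <- s) ('X - c%:P))^`().[x] =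
  (\prod_(c <- s) ('X - c%:P)).[x] * \sum_(c <- s) (x - c)^-1.
Proof.
elim: s => [|c s IH]; first by rewrite !big_nil derivC hornerC mulr0.
rewrite inE negb_or => /andP[xc /IH {}IH].
rewrite !big_cons derivM derivXsubC mul1r hornerD !hornerM IH hornerXsubC mulrDr.
congr (_ + _); last by rewrite mulrA.
by rewrite mulrAC divff ?mul1r // subr_eq0.
Qed.

Definition archimedean (G : orderedGroupType) : Prop :=
  forall g h : G, 0 < g -> exists n : nat, h < g *+ n.

(** * Approximation of the cut, close and far roots *)

Section Core.
Variables (K : fieldType) (Omega : closedFieldType) (iota : {rmorphism K -> Omega}).
Variables (G : orderedGroupType) (w : valuation Omega G) (y : Omega) (cv : K -> G).
Hypothesis arch : archimedean G.
Hypothesis cvE : forall b, w (y - iota b) = Fin (cv b).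
Hypothesis nomax : forall b, exists b', cv b < cv b'.
Hypothesis bnd : exists M, forall b, cv b <= M.

(** Otherwise [cv b *+ n] could be raised by t again and again, and the archimedean property would
    carry it past the bound M. *)
Lemma cv_approx n b1 (t : G) : (0 < n)%N -> 0 < t ->
  exists2 b, cv b1 <= cv b & forall b', cv b' *+ n < t + cv b *+ n.
Proof.
move=> n0 t0; apply: contrapT => H.
have step b : cv b1 <= cv b -> exists2 b', cv b1 <= cv b' & t + cv b *+ n <= cv b' *+ n.
  move=> bb; apply: contrapT => H'; apply: H; exists b => // b'.
  rewrite og_ltNge; apply/negP => le; apply: H'; exists b' => //.
  apply: le_trans bb _; rewrite -(@og_le_Mn _ n) //; apply: le_trans le.
  by rewrite -{1}[cv b *+ n]add0r og_le2r ltW.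
have iter k : exists2 b, cv b1 <= cv b & t *+ k + cv b1 *+ n <= cv b *+ n.
  elim: k => [|k [b b1b hb]]; first by exists b1 => //; rewrite add0r.
  have [b' b1b' hb'] := step _ b1b; exists b' => //; apply: le_trans hb'.
  by rewrite mulrS -addrA og_le2l.
have [M hM] := bnd; have [k hk] := arch (M *+ n - cv b1 *+ n) t0.
have [b _ hb] := iter k; have := le_lt_trans (og_le_MnW n (hM b)) _.
move=> /(_ (t *+ k + cv b1 *+ n)); rewrite -(og_lt2r (- (cv b1 *+ n))) addrK => /(_ hk).
by move=> /(le_lt_trans hb); rewrite ltxx.
Qed.

Definition close (c : Omega) : Prop := forall b, Fin (cv b) < w (y - c).

Lemma not_close c : ~ close c -> exists b, w (y - c) <= Fin (cv b).
Proof.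
move=> nc; apply: contrapT => H; apply: nc => b; rewrite ltNge; apply/negP => h.
by apply: H; exists b.
Qed.

Lemma close_base b : ~ close (iota b).
Proof. by move=> /(_ b); rewrite cvE ltxx. Qed.

Lemma close_y : close y.
Proof. by move=> b; rewrite subrr val0 Fin_lt. Qed.

Lemma far_bound (s : seq Omega) :
  exists b, forall c, c \in s -> ~ close c -> w (y - c) <= Fin (cv b).
Proof.
elim: s => [|c s [b hb]]; first by exists 0.
have [[b' hb']|cc] : (exists b', w (y - c) <= Fin (cv b')) \/ close c.
  by have [|/not_close] := pselect (close c); [right|left].
  have [le|le] := orP (og_le_total (cv b) (cv b')).
    exists b' => d; rewrite inE => /orP[/eqP->//|ds nd].
    by apply: le_trans (hb _ ds nd) _.
  exists b => d; rewrite inE => /orP[/eqP-> _|]; last exact: hb.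
  exact: le_trans hb' _.
by exists b => d; rewrite inE => /orP[/eqP->//|]; apply: hb.
Qed.

Lemma val_sub_close b c : close c -> w (iota b - c) = Fin (cv b).
Proof.
move=> cc; rewrite -(subrKA y) addrC valDr -1?valB ?cvE //.
Qed.

Lemma val_sub_far b b0 c : cv b0 < cv b -> w (y - c) <= Fin (cv b0) ->
  w (iota b - c) = w (y - c).
Proof.
move=> bb h; rewrite -(subrKA y) valDr //.
by rewrite [w (iota b - y)]valB cvE; apply: le_lt_trans h _; rewrite Fin_lt.
Qed.

Definition ncloseb : pred Omega := fun c => `[< close c >].

Lemma closed_roots (P : {poly Omega}) :
  exists s : seq Omega, P = lead_coef P *: \prod_(c <- s) ('X - c%:P).
Proof. by have [s] := closed_field_poly_normal P; exists s. Qed.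

(* If the number m of close roots c were a unit, the Newton step from b would
   give b' with w(b' - c) = w(t (b - c)), where m + t is (b - c) f'/f at b.
   Close roots contribute more than every [cv b'] to t (b - c), far ones at
   least 2 cv b - cv b0, so that w(b' - c) > cv b', which is absurd. *)
Lemma close_count (f : {poly K}) (l : Omega) (s : seq Omega) : f != 0 ->
  map_poly iota f = l *: \prod_(c <- s) ('X - c%:P) ->
  (0 < count ncloseb s)%N -> Fin 0 < w (count ncloseb s)%:R.
Proof.
move=> f0 fs; rewrite -has_count => /hasP[c cs /asboolP cc].
have := val_nat_ge0 w (count ncloseb s); set m := count _ s.
rewrite le_eqVlt => /orP[/eqP/esym wm|//].
have l0 : l != 0.
  apply: contraTneq f0 => l0; move/eqP: fs; rewrite l0 scale0r map_poly_eq0.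
  by move=> ->.
have [b0 hb0] := far_bound s.
have [b1 hb1] := nomax b0.
(* With this slack every b' satisfies cv b' + cv b0 < cv b1 + cv b <= 2 cv b, which is what the far
   roots require at the end. *)
have th : 0 < cv b1 - cv b0 by rewrite og_subr_gt0.
have [b b1b hb] := cv_approx b1 (ltn0Sn 0) th.
have b0b : cv b0 < cv b by apply: lt_le_trans b1b.
(* The Newton step for a root of multiplicity m: b' = b - m f(b) / f'(b). *)
pose N := \sum_(d <- s) (iota b - d)^-1.
have bNs : iota b \notin s.
  apply/negP => bs; have := hb0 _ bs (@close_base b); rewrite cvE Fin_le.
  by move=> /(lt_le_trans b0b); rewrite ltxx.
have fb0 : (map_poly iota f).[iota b] != 0.
  rewrite fs hornerZ mulf_neq0 // -[_ == 0]/(root _ _) root_prod_XsubC //.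
have f'b : (map_poly iota f)^`().[iota b] = (map_poly iota f).[iota b] * N.
  by rewrite fs derivZ !hornerZ prod_XsubC_logderiv // mulrA.
pose u := iota b - c.
have wu : w u = Fin (cv b) by apply: val_sub_close.
have u0 : u != 0 by rewrite -(val_PInf w) wu.
(* For a close d, u = (b - d) + (d - c), so u / (b - d) is 1 plus a small term; these ones add up to
   m, and t collects the rest. *)
pose t := \sum_(d <- s) (if ncloseb d then (d - c) / (iota b - d) else u / (iota b - d)).
have uN : u * N = m%:R + t.
  rewrite /N /t /m mulr_sumr -sum1_count natr_sum.
  rewrite [\sum_(i <- s | ncloseb i) _]big_mkcond -big_split /=; apply: eq_big_seq => d ds.
  have bd0 : iota b - d != 0 by rewrite subr_eq0; apply: contraNneq bNs => ->.
  case: ifP => _; last by rewrite add0r.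
  by apply: (mulIf bd0) => /=; rewrite [RHS]mulrDl !mulfVK // mul1r /u addrA subrK.
have close_dc d : close d -> forall b', Fin (cv b') < w (d - c).
  move=> dc b'; rewrite -(subrKA y); apply: val_ltD; last exact: cc.
  by rewrite valB; apply: dc.
have wt : Fin 0 < w t.
  apply: val_sum_gt => d ds _.
  have bd0 : iota b - d != 0 by rewrite subr_eq0; apply: contraNneq bNs => ->.
  rewrite -(Defs.val1 w) -(val_lt2r _ _ _ bd0) mul1r.
  case: ifP => [/asboolP dc|/asboolP dc]; rewrite mulfVK //.
    by rewrite (val_sub_close b dc); apply: close_dc.
  rewrite (val_sub_far b0b (hb0 _ ds dc)) wu.
  by apply: le_lt_trans (hb0 _ ds dc) _; rewrite Fin_lt.
have wmt : w (m%:R + t) = w 1 by rewrite valDl ?wm ?Defs.val1.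
have mt0 : m%:R + t != 0 by rewrite -(val_PInf w) wmt Defs.val1.
have N0 : N != 0 by apply: contraNneq mt0 => N0; rewrite -uN N0 mulr0.
pose b' := b - (f.[b] / f^`().[b]) *+ m.
have eb' : iota b' - c = u * t / (m%:R + t).
  have -> : iota b' - c = u - m%:R / N.
    rewrite /b' rmorphB rmorphMn fmorph_div -!horner_map /= -deriv_map f'b.
    by rewrite invfM mulrA divff // mul1r -mulr_natl addrAC.
  have -> : t = u * N - m%:R by rewrite uN addrC addKr.
  by rewrite [m%:R + _]addrC subrK; field; rewrite N0 u0.
have wb' := val_sub_close b' cc.
have : Fin (cv b') < w (u * t).
  rewrite /t mulr_sumr; apply: val_sum_gt => d ds _.
  have bd0 : iota b - d != 0 by rewrite subr_eq0; apply: contraNneq bNs => ->.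
  rewrite -(cvE b') -(val_lt2r _ _ _ bd0).
  case: ifP => [/asboolP dc|/asboolP dc]; rewrite -(mulrA u) mulfVK //.
    have -> : w (u * (d - c)) = w ((iota b - d) * (d - c)).
      by apply: val_congM; rewrite // (val_sub_close b dc).
    by rewrite mulrC val_lt2l // cvE; apply: close_dc.
  have wd := hb0 _ ds dc; have [g wg] := val_Fin w bd0.
  rewrite !Defs.valM wu cvE wg Fin_ltE /=.
  have gb0 : g <= cv b0 by rewrite -Fin_le -wg (val_sub_far b0b wd).
  apply: (@le_lt_trans _ _ (cv b' + cv b0)); first by rewrite og_le2l.
  have := hb b'; rewrite !mulr1n -(og_lt2r (cv b0)) addrAC subrK => /lt_le_trans; apply.
  by rewrite og_le2r.
have -> : w (u * t) = Fin (cv b').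
  by rewrite -wb' eb' -[RHS](valMl1 _ wmt) [(m%:R + t) * _]mulrC mulfVK.
by rewrite ltxx.
Qed.

(** * Polynomials with close roots and their Taylor coefficients *)

Variable p : nat.
Hypothesis pp : prime p.
Hypothesis wp : Fin 0 < w p%:R.
Hypothesis wnat : forall i, (0 < i < p)%N -> w i%:R = Fin 0.

Local Notation z b := (y - iota b).
Local Notation fm := (map_poly iota).

Lemma z_neq0 b : z b != 0.
Proof. by rewrite -(val_PInf w) cvE. Qed.

Lemma map_roots (f : {poly K}) : f != 0 -> exists2 s : seq Omega,
  fm f = iota (lead_coef f) *: \prod_(c <- s) ('X - c%:P) &
  size s = (size f).-1 /\ (forall c, (c \in s) = root (fm f) c).
Proof.
move=> f0; have [s sE] := closed_roots (fm f).
have l0 : lead_coef (fm f) != 0 by rewrite lead_coef_eq0 map_poly_eq0.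
exists s; first by rewrite -lead_coef_map.
split; first by rewrite -(size_map_poly iota) sE size_scale // size_prod_XsubC.
by move=> c; rewrite sE rootZ // root_prod_XsubC.
Qed.

Lemma small_far (f : {poly K}) c : f != 0 -> (size f <= p)%N ->
  root (fm f) c -> ~ close c.
Proof.
move=> f0 fp rc cc; have [s sE [ss smem]] := map_roots f0.
have cs : (0 < count ncloseb s)%N.
  by rewrite -has_count; apply/hasP; exists c; rewrite ?smem //; apply/asboolP.
have := close_count f0 sE cs; rewrite wnat ?ltxx // cs /=.
apply: leq_ltn_trans (count_size _ _) _; rewrite ss.
by rewrite -subn1 ltn_subLR ?size_poly_gt0 // add1n ltnS.
Qed.

Lemma monic_close (f : {poly K}) c : f \is monic -> size f = p.+1 ->
  root (fm f) c -> close c ->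
  exists2 s, fm f = \prod_(d <- s) ('X - d%:P) &
    size s = p /\ forall d, d \in s -> close d.
Proof.
move=> fmon sf rc cc; have f0 : f != 0 by rewrite monic_neq0.
have [s sE [ss smem]] := map_roots f0; exists s.
  by rewrite sE (monicP fmon) rmorph1 scale1r.
have {}ss : size s = p by rewrite ss sf.
split=> // d.
have cs : (0 < count ncloseb s)%N.
  by rewrite -has_count; apply/hasP; exists c; rewrite ?smem //; apply/asboolP.
have cp : count ncloseb s = size s.
  have := close_count f0 sE cs; have := count_size ncloseb s; rewrite leq_eqVlt.
  by case/orP => [/eqP //|]; rewrite {1}ss => h; rewrite wnat ?ltxx // cs.
by move=> ds; apply/asboolP; move/eqP: cp; rewrite -all_count => /allP; apply.
Qed.

Lemma val_prod_ge (s : seq Omega) (u : Omega -> Omega) (r : Omega) :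
  (forall c, c \in s -> w r <= w (u c)) -> w (r ^+ size s) <= w (\prod_(c <- s) u c).
Proof.
elim: s => [|c s IH] h; first by rewrite big_nil.
rewrite big_cons exprS; apply: val_leM; first by apply: h; rewrite mem_head.
by apply: IH => d ds; apply: h; rewrite inE ds orbT.
Qed.

Lemma val_prod_le (s : seq Omega) (u : Omega -> Omega) (r : Omega) :
  (forall c, c \in s -> w (u c) <= w r) -> w (\prod_(c <- s) u c) <= w (r ^+ size s).
Proof.
elim: s => [|c s IH] h; first by rewrite big_nil.
rewrite big_cons exprS; apply: val_leM; first by apply: h; rewrite mem_head.
by apply: IH => d ds; apply: h; rewrite inE ds orbT.
Qed.

Lemma val_zX_lt n b b' : (0 < n)%N -> (w (z b ^+ n) < w (z b' ^+ n)) = (cv b < cv b').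
Proof. by move=> n0; rewrite !(val_FinX _ (cvE _)) Fin_ltE og_lt_Mn. Qed.

Lemma close_ge b c : close c -> w (z b) <= w (y - c).
Proof. by move=> cc; rewrite cvE ltW. Qed.

(** If one root is close, all p factors y - d of f(y) exceed D. If none is, a single b bounds all
    the factors, and f(y) has value at most p cv b. *)
Lemma closeP (f : {poly K}) : f \is monic -> size f = p.+1 ->
  (exists2 c, root (fm f) c & close c) <-> (forall b, w (z b ^+ p) < w (fm f).[y]).
Proof.
move=> fmon sf; have f0 : f != 0 by rewrite monic_neq0.
split=> [[c rc cc] b|h].
  have [s -> [ss sc]] := monic_close fmon sf rc cc.
  have [b' bb'] := nomax b.
  apply: (@lt_le_trans _ _ (w (z b' ^+ p))); first by rewrite val_zX_lt ?prime_gt0.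
  by rewrite -ss horner_prod; apply: val_prod_ge => d /sc dc; rewrite hornerXsubC close_ge.
apply: contrapT => nc; have [s sE [ss smem]] := map_roots f0.
have [b hb] := far_bound s; have := h b.
rewrite sE (monicP fmon) rmorph1 scale1r horner_prod ltNge => /negP; apply.
have {}ss : size s = p by rewrite ss sf.
rewrite -ss; apply: val_prod_le => d ds; rewrite hornerXsubC cvE.
by apply: hb => // dc; apply: nc; exists d; rewrite -?smem.
Qed.

(** After the substitution of r X for X, the factor r X - d raises the values of all coefficients by
    at least w t. Taking t = r serves the roots inside the disc of radius r, taking t = d those
    outside. *)
Lemma coef_mulXsubC_ge (P : {poly Omega}) (t r d q : Omega) :
  w t <= w r -> w t <= w d -> (forall j, w q <= w (P`_j * r ^+ j)) ->
  forall j, w (t * q) <= w ((('X - d%:P) * P)`_j * r ^+ j).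
Proof.
move=> tr td h j; rewrite mulrBl coefB coefXM coefCM mulrBl.
apply: val_leD; last by rewrite valN -mulrA; apply: val_leM.
by case: j => [|j] /=; [rewrite mul0r val0 le_PInf | rewrite exprS mulrCA val_leM].
Qed.

Lemma coef_prod_close (s : seq Omega) (r : Omega) :
  (forall d, d \in s -> w r <= w d) ->
  forall j, w (r ^+ size s) <= w ((\prod_(d <- s) ('X - d%:P))`_j * r ^+ j).
Proof.
elim: s => [|d s IH] h j.
  rewrite big_nil coefC /=; case: eqP => [->|_]; first by rewrite mul1r.
  by rewrite mul0r val0 le_PInf.
rewrite big_cons exprS; apply: coef_mulXsubC_ge => //; first by apply: h; rewrite mem_head.
by apply: IH => e es; apply: h; rewrite inE es orbT.
Qed.

Lemma coef_prod_far (s : seq Omega) (r : Omega) :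
  (forall d, d \in s -> w d <= w r) -> forall j,
  w (\prod_(d <- s) ('X - d%:P))`_0 <= w ((\prod_(d <- s) ('X - d%:P))`_j * r ^+ j).
Proof.
elim: s => [|d s IH] h j.
  rewrite big_nil !coefC /=; case: eqP => [->|_]; first by rewrite mulr1.
  by rewrite mul0r val0 le_PInf.
have -> : w (\prod_(d <- d :: s) ('X - d%:P))`_0 =
          w (d * (\prod_(d <- s) ('X - d%:P))`_0).
  by rewrite big_cons mulrBl coefB coefXM coefCM sub0r valN.
rewrite big_cons; apply: coef_mulXsubC_ge => //; first by apply: h; rewrite mem_head.
by apply: IH => e es; apply: h; rewrite inE es orbT.
Qed.

Lemma comp_prod (s : seq Omega) (x : Omega) :
  (\prod_(d <- s) ('X - d%:P)) \Po ('X + x%:P) = \prod_(d <- [seq c - x | c <- s]) ('X - d%:P).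
Proof.
rewrite big_map; elim: s => [|d s IH]; first by rewrite !big_nil comp_polyC.
rewrite !big_cons comp_polyM IH comp_polyB comp_polyX comp_polyC polyCB.
by rewrite opprB addrA.
Qed.

Definition ev_close (P : K -> Prop) : Prop :=
  exists b0, forall b, cv b0 <= cv b -> P b.

Lemma ev_close_and P Q : ev_close P -> ev_close Q -> ev_close (fun b => P b /\ Q b).
Proof.
move=> [b1 h1] [b2 h2]; have [le|le] := orP (og_le_total (cv b1) (cv b2)).
  by exists b2 => b hb; split; [apply: h1; apply: le_trans hb|apply: h2].
by exists b1 => b hb; split; [apply: h1|apply: h2; apply: le_trans hb].
Qed.

Lemma ev_close_imp (P Q : K -> Prop) : (forall b, P b -> Q b) -> ev_close P -> ev_close Q.
Proof. by move=> PQ [b0 h]; exists b0 => b /h/PQ. Qed.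

Lemma ev_close_ex P : ev_close P -> exists b, P b.
Proof. by move=> [b h]; exists b; apply: h. Qed.

(* With D the cut of the values [cv b], this says w x > p D; [exceeds_pred] below says w x > (p - 1) D. *)
Definition exceeds_p (x : Omega) : Prop := forall b, w (z b ^+ p) < w x.

Lemma exceeds_pD x x' : exceeds_p x -> exceeds_p x' -> exceeds_p (x + x').
Proof. by move=> h h' b; rewrite (val_FinX _ (cvE _)) val_ltD // -(val_FinX _ (cvE b)). Qed.

Lemma exceeds_pN x : exceeds_p x -> exceeds_p (- x).
Proof. by move=> h b; rewrite valN. Qed.

Lemma exceeds_p_sum (I : eqType) (s : seq I) (f : I -> Omega) :
  (forall i, i \in s -> exceeds_p (f i)) -> exceeds_p (\sum_(i <- s) f i).
Proof.
move=> h b; rewrite (val_FinX _ (cvE _)); apply: val_sum_gt => i /h h' _.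
by rewrite -(val_FinX _ (cvE b)).
Qed.

Lemma exceeds_p0 : exceeds_p 0.
Proof. by move=> b; rewrite val0 (val_FinX _ (cvE _)) Fin_lt. Qed.

Definition exceeds_pred (x : Omega) : Prop := ev_close (fun b => exceeds_p (x * z b)).

Lemma exceeds_predP x b : exceeds_p (x * z b) -> exceeds_pred x.
Proof.
by move=> h; exists b => b1 bb1 b2; apply: lt_le_trans (h b2) _; apply: val_leM; rewrite // !cvE.
Qed.

Lemma exceeds_predD x x' : exceeds_pred x -> exceeds_pred x' -> exceeds_pred (x + x').
Proof.
by move=> h h'; apply: ev_close_imp (ev_close_and h h') => b [? ?]; rewrite mulrDl; apply: exceeds_pD.
Qed.

(** For b near y, p D lies less than w e above p cv b. *)
Lemma exceeds_p_pz e : Fin 0 < w e -> ev_close (fun b => exceeds_p (e * z b ^+ p)).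
Proof.
move=> we; have [->|/(val_Fin w)[t wt]] := eqVneq e 0.
  by exists 0 => b _; rewrite mul0r; apply: exceeds_p0.
have t0 : 0 < t by move: we; rewrite wt Fin_ltE.
have [b1 _ h] := cv_approx 0 (prime_gt0 pp) t0.
exists b1 => b b1b b'; rewrite Defs.valM wt !(val_FinX _ (cvE _)) Fin_ltE.
by apply: lt_le_trans (h b') _; rewrite og_le2l og_le_MnW.
Qed.


Definition limit_poly (F : {poly K}) : Prop :=
  [/\ F \is monic, size F = p.+1 & exceeds_p (fm F).[y]].

Local Notation T F := (fm F \Po ('X + y%:P)).

Lemma limit_poly_close F : limit_poly F -> exists2 s, fm F = \prod_(d <- s) ('X - d%:P) &
  size s = p /\ forall d, d \in s -> close d.
Proof. by move=> [Fm sF /(closeP Fm sF)[c rc cc]]; apply: monic_close rc cc. Qed.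

Lemma size_shift (P : {poly Omega}) x : size (P \Po ('X + x%:P)) = size P.
Proof. by rewrite size_comp_poly2 // size_XaddC. Qed.

(** The roots of F shifted by y all have value at least cv b', so the linear coefficient F'(y) has
    value at least (p - 1) cv b'. Strictness comes from choosing b' beyond b. *)
Lemma limit_poly_deriv F b : limit_poly F -> w (z b ^+ p.-1) < w (fm F)^`().[y].
Proof.
move=> /limit_poly_close[s sE [ss sc]]; have [b' bb'] := nomax b.
have := @coef_prod_close [seq c - y | c <- s] (z b') _ 1.
rewrite -comp_prod -sE shift1 size_map ss expr1 => h.
rewrite -(val_lt2r w _ _ (z_neq0 b')).
apply: (@lt_le_trans _ _ (w (z b' ^+ p))); last first.
  by apply: h => _ /mapP[c cs ->]; rewrite [w (c - y)]valB; apply/close_ge/sc.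
rewrite -[p in ltRHS](prednK (prime_gt0 pp)) exprSr val_lt2r ?z_neq0 //.
by rewrite val_zX_lt // -subn1 subn_gt0 prime_gt1.
Qed.

Lemma wnat_neq0 i : (0 < i < p)%N -> i%:R != 0 :> Omega.
Proof. by move=> /wnat wi; rewrite -(val_PInf w) wi. Qed.

Lemma val_mulrn x i : (0 < i < p)%N -> w (x *+ i) = w x.
Proof. by move=> /wnat wi; rewrite -mulr_natl valMl1 // wi Defs.val1. Qed.

(** Up to the unit j + 1, the Taylor coefficient of index j + 1 of F is that of index j of F'. As
    deg F' < p, the roots of F' are far, and some b0 bounds their distances to y; on the disc of
    radius [z b0] the constant coefficient F'(y) then has the least value. *)
Lemma deriv_coef_ge (F : {poly K}) : (size F <= p.+1)%N -> exists b0, forall j, (j.+1 < p)%N ->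
  w (T F)`_1 <= w ((T F)`_j.+1 * z b0 ^+ j).
Proof.
move=> sF; have eD : (T F)^`() = T F^`() by rewrite deriv_shift deriv_map.
have eC j : (T F)`_j.+1 *+ j.+1 = (T F^`())`_j by rewrite -coef_deriv eD.
have [D0|D0] := eqVneq F^`() 0.
  exists 0 => j jp; have /eqP := eC j.
  rewrite D0 map_poly0 comp_poly0 coef0 -mulr_natl mulf_eq0.
  by rewrite (negPf (wnat_neq0 _)) //= => /eqP->; rewrite mul0r val0 le_PInf.
have sD : (size F^`() <= p)%N by apply: leq_trans (size_poly _ _) _; case: (size F) sF.
have [s sE [ss smem]] := map_roots D0; have [b0 hb0] := far_bound s.
exists b0 => j jp; have := @coef_prod_far [seq c - y | c <- s] (z b0) _ j.
rewrite -comp_prod => h.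
rewrite -[(T F)`_1]mulr1n eC.
have <- : w ((T F)`_j.+1 * z b0 ^+ j *+ j.+1) = w ((T F)`_j.+1 * z b0 ^+ j).
  by rewrite val_mulrn ?jp.
rewrite -mulrnAl eC.
rewrite sE comp_polyZ !coefZ -mulrA; apply: val_leM => //; apply: h.
move=> _ /mapP[c cs ->]; rewrite [w (c - y)]valB cvE; apply: hb0 => //.
by apply: (small_far D0 sD); rewrite -smem.
Qed.

(** The term of degree j has value at least w(F'(y)) - (j - 1) cv b0 + j cv b, and w(F'(y)) > (p -
    1) cv b'. Since cv b' + cv b0 <= 2 cv b and cv b0 <= cv b, the total is more than p cv b'. *)
Lemma rest_term F : limit_poly F ->
  ev_close (fun b => forall j, (1 < j < p)%N -> exceeds_p ((T F)`_j * z b ^+ j)).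
Proof.
move=> lF; have [_ sF _] := lF.
have [b0 h0] := deriv_coef_ge (eq_leq sF); have [b1 b01] := nomax b0.
have [b2 b12 h2] := cv_approx b1 (ltn0Sn 0) (etrans (og_subr_gt0 _ _) b01).
exists b2 => b b2b [//|[//|j]] /= jp b'.
have zle : w (z b0) <= w (z b).
  by rewrite !cvE Fin_le; apply: le_trans (ltW b01) (le_trans b12 b2b).
have zz : w (z b' * z b0) <= w (z b ^+ 2).
  rewrite Defs.valM (val_FinX _ (cvE _)) !cvE Fin_le mulr2n.
  have := h2 b'; rewrite !mulr1n -(og_lt2r (cv b0)) addrAC subrK => /ltW/le_trans; apply.
  by apply: og_leD; rewrite // (le_trans b12).
have r0 : z b0 ^+ j.+1 != 0 by rewrite expf_neq0 // z_neq0.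
rewrite -(val_lt2r w _ _ r0) mulrAC.
apply: (@lt_le_trans _ _ (w ((T F)`_1 * z b ^+ j.+2))); last exact: val_leM (h0 _ jp) _.
have -> : z b' ^+ p * z b0 ^+ j.+1 = z b' ^+ p.-1 * (z b' * z b0 * z b0 ^+ j).
  by rewrite -[p in LHS](prednK (prime_gt0 pp)) exprSr exprS !mulrA.
rewrite shift1; apply: val_lt_leM; first exact: limit_poly_deriv.
  rewrite -[z b ^+ j.+2]/(z b ^+ (2 + j)) exprD; apply: val_leM => //; exact: val_leX.
by rewrite !mulf_neq0 ?expf_neq0 ?z_neq0.
Qed.

Lemma exceeds_p_ge0 e x : Fin 0 <= w e -> exceeds_p x -> exceeds_p (e * x).
Proof.
move=> we ox b; apply: lt_le_trans (ox b) _; rewrite -{1}[x]mul1r.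
by apply: val_leM => //; rewrite Defs.val1.
Qed.

(** Common to both truncations. Evaluation at [- z b] is the expansion at y evaluated at b: the
    constant term is F(y), the middle terms are harmless by [rest_term], and the power of degree p
    nearly cancels against the added [z b ^+ p]. Only the linear term has to be compensated. *)
Lemma exceeds_p_horner F (U : {poly Omega}) (e : nat -> Omega) : limit_poly F ->
  (size U <= p.+1)%N -> U`_0 = (T F)`_0 ->
  (forall j, (1 < j < p)%N -> U`_j = e j * (T F)`_j /\ Fin 0 <= w (e j)) ->
  Fin 0 < w (U`_p * (-1) ^+ p + 1) ->
  ev_close (fun b => exceeds_p (U.[- z b] + U`_1 * z b + z b ^+ p)).
Proof.
move=> lF sU U0 Uj Up; have [_ _ oF] := lF.
apply: ev_close_imp (ev_close_and (rest_term lF) (exceeds_p_pz Up)) => b [hr hp].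
rewrite (horner_coef_wide _ sU) big_ord_recr /=.
have p1 : p = p.-2.+2 by move: (prime_gt1 pp); case: (p) => [|[]].
have bigE (f : nat -> Omega) : \sum_(i < p) f i = f 0%N + (f 1%N + \sum_(i < p.-2) f i.+2).
  have -> : \sum_(i < p) f i = \sum_(i < p.-2.+2) f i by rewrite -p1.
  by rewrite 2!big_ord_recl.
rewrite (bigE (fun i => U`_i * (- z b) ^+ i)) /= expr0 mulr1 expr1.
have -> : U`_0 + (U`_1 * - z b + \sum_(i < p.-2) U`_i.+2 * (- z b) ^+ i.+2) +
    U`_p * (- z b) ^+ p + U`_1 * z b + z b ^+ p =
  U`_0 + (\sum_(i < p.-2) U`_i.+2 * (- z b) ^+ i.+2 +
   (U`_p * (-1) ^+ p + 1) * z b ^+ p).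
  by rewrite [(- z b) ^+ p]exprNn; ring.
rewrite U0 shift0; do 2?apply: exceeds_pD => //.
apply: exceeds_p_sum => i _; have ip : (1 < i.+2 < p)%N by have := ltn_ord i; rewrite -2!ltnS -p1.
have [-> we] := Uj _ ip; rewrite exprNn mulrCA -signr_odd.
apply: exceeds_p_ge0.
  by case: (odd _); [rewrite expr1 valN1|rewrite expr0 Defs.val1].
by rewrite -mulrA; apply: exceeds_p_ge0 (hr _ ip).
Qed.


Lemma shift_eval (P : {poly Omega}) b : (P \Po ('X + y%:P)).[- z b] = P.[iota b].
Proof. by rewrite horner_comp hornerD hornerX hornerC opprB subrK. Qed.

Lemma limit_poly_coefp F : limit_poly F -> (T F)`_p = 1.
Proof.
move=> /limit_poly_close[s -> [ss _]]; rewrite comp_prod.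
have /monicP := monic_prod_XsubC [seq c - y | c <- s] xpredT id.
by rewrite lead_coefE size_prod_XsubC size_map ss.
Qed.

Lemma size_T F : limit_poly F -> (size (T F) <= p.+1)%N.
Proof. by move=> [_ sF _]; rewrite size_shift size_map_poly sF. Qed.

Lemma prime_parity : p = 2%N \/ odd p.
Proof. exact: even_prime. Qed.

Lemma exceeds_p_trunc0 F : limit_poly F ->
  ev_close (fun b => exceeds_p ((fm ((F.[b])%:P + ('X - b%:P) ^+ p)).[y] + (T F)`_1 * z b)).
Proof.
move=> lF; have := @exceeds_p_horner F (T F) (fun=> 1) lF (size_T lF) erefl.
move=> h; apply: (ev_close_imp _ (h _ _)).
- move=> b; rewrite shift_eval -addrA [_ * _ + _]addrC addrA.
  rewrite rmorphD rmorphXn rmorphB /= !map_polyC map_polyX /= hornerD hornerC.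
  by rewrite horner_exp hornerXsubC horner_map.
- by move=> j _; split; rewrite ?mul1r ?Defs.val1.
(* The remaining coefficient (-1)^p + 1 is 2 = p or 0. *)
- rewrite (limit_poly_coefp lF) mul1r; have [p2|op] := prime_parity.
    by move: wp; rewrite p2 sqrrN expr1n.
  by rewrite -signr_odd op expr1 addNr val0 Fin_lt.
Qed.

Lemma exceeds_p_trunc1 F : limit_poly F ->
  ev_close (fun b => exceeds_p (fm ((F.[b])%:P + (F^`().[b])%:P * ('X - b%:P) + ('X - b%:P) ^+ p)).[y]).
Proof.
(* At [- z b] this U takes the value F(b) + F'(b) (y - b), and its linear coefficient is 0: the
   coefficient of index j is multiplied by 1 - j. *)
move=> lF; pose U := T F - 'X * (T F)^`().
have eU j : U`_j = (1 - j%:R) * (T F)`_j.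
  rewrite coefB coefXM mulrBl mul1r; case: j => [|j]; first by rewrite mul0r.
  by rewrite coef_deriv mulr_natl.
have := @exceeds_p_horner F U (fun j => 1 - j%:R) lF.
have sU : (size U <= p.+1)%N.
  by apply/leq_sizeP => j jp; rewrite eU nth_default ?mulr0 // (leq_trans (size_T lF)).
move=> /(_ sU) h; apply: (ev_close_imp _ (h _ _ _)).
- move=> b; rewrite eU subrr mul0r mul0r addr0.
  rewrite hornerD hornerN hornerM hornerX deriv_shift !shift_eval deriv_map.
  rewrite !rmorphD rmorphM rmorphXn rmorphB /= !map_polyC map_polyX /= !hornerD hornerM !hornerC.
  by rewrite horner_exp hornerXsubC !horner_map /= mulNr opprK [_ * z b]mulrC.
- by rewrite eU subr0 mul1r.
- move=> j _; split; first exact: eU.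
  by apply: val_leD; rewrite ?valN ?Defs.val1 // val_nat_ge0.
(* The remaining coefficient (1 - p) (-1)^p + 1 is 0 for p = 2 and p for odd p. *)
- rewrite eU (limit_poly_coefp lF) mulr1; have [->|op] := prime_parity.
    by rewrite (_ : _ + 1 = 0) ?val0 ?Fin_lt //; ring.
  by rewrite -signr_odd op expr1 mulrN1 opprB subrK.
Qed.

Lemma exceeds_predE F : limit_poly F -> exceeds_pred (T F)`_1 <->
  ev_close (fun b => exceeds_p (fm ((F.[b])%:P + ('X - b%:P) ^+ p)).[y]).
Proof.
move=> lF; split=> h; apply: ev_close_imp (ev_close_and h (exceeds_p_trunc0 lF)) => b [h1 h2].
  by rewrite -[_.[y]](addrK ((T F)`_1 * z b)); apply: exceeds_pD => //; apply: exceeds_pN.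
rewrite -[_ * z b](addKr (fm (F.[b]%:P + ('X - b%:P) ^+ p)).[y]).
by apply: exceeds_pD => //; apply: exceeds_pN.
Qed.

Lemma roots_far_bound (h : {poly K}) : h != 0 -> (size h <= p)%N ->
  exists b0, forall c, root (fm h) c -> w (y - c) <= w (z b0).
Proof.
move=> h0 hp; have [s _ [_ smem]] := map_roots h0; have [b0 hb0] := far_bound s.
by exists b0 => c rc; rewrite cvE; apply: hb0; rewrite ?smem //; apply: small_far rc.
Qed.

Lemma ev_close_neq0 (h : {poly K}) : h != 0 -> (size h <= p)%N -> ev_close (fun b => h.[b] != 0).
Proof.
move=> h0 hp; have [b0 hb0] := roots_far_bound h0 hp; have [b1 b01] := nomax b0.
exists b1 => b b1b; apply/negP => hb; have := hb0 (iota b); rewrite !cvE Fin_le.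
rewrite /root horner_map (eqP hb) rmorph0 eqxx => /(_ isT).
by move=> /(lt_le_trans (lt_le_trans b01 b1b)); rewrite ltxx.
Qed.

(** h'(y) / h(y) is the sum of the 1 / (y - c) over the roots c, and each has value at least - cv b0
    because no root is close. *)
Lemma logderiv_ge (h : {poly K}) : h != 0 -> (size h <= p)%N ->
  exists b0, w (fm h).[y] <= w ((fm h^`()).[y] * z b0).
Proof.
move=> h0 hp; have [b0 hb0] := roots_far_bound h0 hp; exists b0.
have [s sE [_ smem]] := map_roots h0.
have ys : y \notin s by rewrite smem; apply/negP => /(small_far h0 hp); apply; apply: close_y.
rewrite -deriv_map sE derivZ !hornerZ prod_XsubC_logderiv // -!mulrA.
apply: val_leM => //; rewrite -{1}[(\prod_(c <- s) _).[y]]mulr1; apply: val_leM => //.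
rewrite mulr_suml; apply: val_sum_ge => c cs _.
have yc : y - c != 0 by rewrite subr_eq0; apply: contraNneq ys => ->.
by rewrite -(val_le2r _ _ _ yc) mul1r mulrAC mulVf // mul1r hb0 // -smem.
Qed.

(** The leading terms cancel, so [logderiv_ge] applies to F - g, whose value at y still exceeds p
    D. *)
Lemma exceeds_pred_deriv_sub F g : limit_poly F -> limit_poly g -> exceeds_pred ((T F)`_1 - (T g)`_1).
Proof.
move=> [Fm sF oF] [gm sg og].
rewrite !shift1 !deriv_map -hornerN -hornerD -rmorphB -derivB.
have oh : exceeds_p (fm (F - g)).[y].
  by rewrite rmorphB hornerD hornerN; apply: exceeds_pD => //; apply: exceeds_pN.
have sh : (size (F - g)%R <= p)%N.
  apply/leq_sizeP => j; rewrite leq_eqVlt => /orP[/eqP<-|pj]; rewrite coefB.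
    have := monicP Fm; have := monicP gm; rewrite !lead_coefE sF sg /= => -> ->.
    by rewrite subrr.
  by rewrite !nth_default ?subrr // ?sF ?sg.
have [->|h0] := eqVneq (F - g) 0.
  by rewrite deriv0 rmorph0 horner0; apply: (@exceeds_predP _ 0); rewrite mul0r; apply: exceeds_p0.
have [b0 hb0] := logderiv_ge h0 sh.
by apply: (@exceeds_predP _ b0) => b; apply: lt_le_trans (oh b) hb0.
Qed.

Lemma exceeds_pred_lim F g : limit_poly F -> limit_poly g -> exceeds_pred (T g)`_1 -> exceeds_pred (T F)`_1.
Proof.
move=> lF lg ag; rewrite -[(T F)`_1](subrK (T g)`_1).
by apply: exceeds_predD => //; apply: exceeds_pred_deriv_sub.
Qed.

Lemma exceeds_pred_deriv0 F : limit_poly F -> F^`() = 0 -> exceeds_pred (T F)`_1.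
Proof.
move=> lF F0; rewrite shift1 deriv_map F0 rmorph0 horner0.
by apply: (@exceeds_predP _ 0); rewrite mul0r; apply: exceeds_p0.
Qed.

(** Every (p - 1) cv b is below kappa by [limit_poly_deriv], so the question is whether an element
    of the divisible group G separates D from kappa / (p - 1). *)
Lemma exceeds_pred_cut F (kappa : G) :
  (forall (n : nat) (g : G), (0 < n)%N -> exists h, h *+ n = g) ->
  limit_poly F -> w (T F)`_1 = Fin kappa ->
  (forall g : G, (exists b, g <= cv b) <-> g *+ p.-1 < kappa) <-> ~ exceeds_pred (T F)`_1.
Proof.
move=> gdiv lF wk; have p0 := prime_gt0 pp.
have p1 : (0 < p.-1)%N by rewrite -subn1 subn_gt0 prime_gt1.
have lt b : cv b *+ p.-1 < kappa.
  by have := limit_poly_deriv b lF; rewrite (val_FinX _ (cvE _)) -shift1 wk Fin_ltE.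
split=> [h /ev_close_ex[b hb]|na g].
  (* (kappa + cv b) / p is below kappa / (p - 1), since (p - 1) cv b < kappa, and above every cv b',
     by the choice of b. *)
  have [g eg] := gdiv p (kappa + cv b) p0.
  have /h[b' gb'] : g *+ p.-1 < kappa.
    rewrite -(@og_lt_Mn _ p) // mulrnAC eg mulrnDl -[X in _ < kappa *+ X](prednK p0).
    by rewrite mulrSr og_lt2l.
  have := hb b'; rewrite Defs.valM wk cvE (val_FinX _ (cvE _)) Fin_ltE -eg.
  by rewrite og_lt_Mn // og_ltNge gb'.
split=> [[b gb]|gk]; first by apply: le_lt_trans (lt b); apply: og_le_MnW.
apply: contrapT => ng; apply: na.
have gt b : cv b < g by rewrite og_ltNge; apply/negP => h; apply: ng; exists b.
(* With precision kappa - (p - 1) g, adding (p - 1) cv b' < (p - 1) g to the bound on cv b' gives p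
   cv b' < kappa + cv b. *)
have [b _ hb] := cv_approx 0 (ltn0Sn 0) (etrans (og_subr_gt0 _ _) gk).
apply: (@exceeds_predP _ b) => b'; rewrite Defs.valM wk cvE (val_FinX _ (cvE _)) Fin_ltE.
have := hb b'; rewrite !mulr1n addrAC -(og_lt2r (g *+ p.-1) (cv b')) subrK; apply: le_lt_trans.
by rewrite -{1}(prednK p0) mulrS og_le2l; apply/og_le_MnW/ltW.
Qed.


(** * Key polynomials and plateaus *)

Variables (nu : valuation {poly K} G) (nubar : valuation {poly Omega} G).
Hypothesis nubarE : forall P, nubar P = w P.[y].
Hypothesis nuE : forall f, nu f = w (fm f).[y].
Variable g : {poly K}.
Hypothesis limit_poly_g : limit_poly g.
Hypothesis g_y : (fm g).[y] = 0.

Local Notation eps := (epsilon iota nubar).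
Local Notation X_ b := ('X - b%:P).

Lemma mem_roots_in (f : {poly K}) c : f != 0 -> (c \in roots_in iota f) = root (fm f) c.
Proof.
rewrite /roots_in => f0; case: closed_field_poly_normal => s /= ->.
by rewrite rootZ ?root_prod_XsubC // lead_coef_eq0 map_poly_eq0.
Qed.

Lemma eps_ge (f : {poly K}) c : f != 0 -> root (fm f) c -> w (y - c) <= eps f.
Proof.
move=> f0 rc; rewrite -(hornerXsubC c) -nubarE /epsilon.
by apply: (le_bigmax_seq _ c); rewrite ?mem_roots_in.
Qed.

Lemma eps_le (f : {poly K}) x : f != 0 -> (forall c, root (fm f) c -> w (y - c) <= x) ->
  eps f <= x.
Proof.
move=> f0 h; rewrite /epsilon big_seq_cond; apply: bigmax_le; first exact: NInf_le.
by move=> c; rewrite mem_roots_in // andbT nubarE hornerXsubC; apply: h.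
Qed.

Lemma nu_XsubC b : nu (X_ b) = Fin (cv b).
Proof. by rewrite nuE rmorphB /= map_polyX map_polyC hornerXsubC cvE. Qed.

Lemma eps_XsubC_ge b : Fin (cv b) <= eps (X_ b).
Proof.
rewrite -cvE; apply: eps_ge; first by rewrite polyXsubC_eq0.
by rewrite rmorphB /= map_polyX map_polyC root_XsubC.
Qed.

Lemma monic_size2 (Q : {poly K}) : Q \is monic -> size Q = 2%N -> exists b, Q = X_ b.
Proof.
move=> Qm sQ; exists (- Q`_0); apply/polyP => i; rewrite polyCN opprK coefD coefX coefC.
case: i => [|[|i]] /=; rewrite ?add0r ?addr0 //; last by rewrite nth_default // sQ.
by have /monicP := Qm; rewrite lead_coefE sQ.
Qed.

Lemma key_XsubC b : key_poly iota nubar (X_ b).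
Proof.
split; rewrite ?monicXsubC ?size_XsubC // => f f0 sf.
apply: lt_le_trans (eps_XsubC_ge b).
have /eqP sf1 : size f == 1%N by rewrite eqn_leq -ltnS sf lt0n size_poly_eq0.
apply: (@le_lt_trans _ _ NInf) => //; apply: eps_le => // c.
have /size_poly1P[a a0 ->] : size f == 1%N by rewrite sf1.
by rewrite map_polyC rootC fmorph_eq0 (negPf a0).
Qed.

Lemma key_polyE Q : key_poly iota nubar Q <-> (exists b, Q = X_ b) \/ limit_poly Q.
Proof.
split=> [[Qm sQ keyQ]|[[b ->]|lQ]]; last first.
- have [Qm sQ oQ] := lQ; split=> //; first by rewrite sQ ltnS prime_gt0.
  move=> f f0; rewrite sQ ltnS => sf.
  have [c rc cc] := (closeP Qm sQ).2 oQ; have [b0 hb0] := roots_far_bound f0 sf.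
  apply: (@le_lt_trans _ _ (w (z b0))); first exact: eps_le.
  by apply: lt_le_trans (eps_ge (monic_neq0 Qm) rc); rewrite cvE; apply: cc.
- exact: key_XsubC.
have Q0 := monic_neq0 Qm; have [/eqP sQ2|sQ2] := boolP (size Q == 2%N).
  by left; apply: monic_size2.
right; have sQ3 : (2 < size Q)%N by rewrite ltn_neqAle eq_sym sQ2.
have [c rc cc] : exists2 c, root (fm Q) c & close c.
  (* If all roots of Q were far, some x - b0 of smaller degree would have an epsilon at least that
     of Q. *)
  apply: contrapT => nc; have [s sE [ss smem]] := map_roots Q0.
  have [b0 hb0] := far_bound s.
  have := keyQ (X_ b0); rewrite polyXsubC_eq0 size_XsubC => /(_ isT sQ3).
  move=> /(le_lt_trans (eps_XsubC_ge b0)); rewrite ltNge => /negP; apply.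
  apply: eps_le => // c rc; apply: hb0; first by rewrite smem.
  by move=> cc; apply: nc; exists c.
have pQ : (p < size Q)%N by rewrite ltnNge; apply/negP => /(small_far Q0)/(_ rc).
have [gm sg og] := limit_poly_g; have g0 := monic_neq0 gm.
have sQ' : size Q = p.+1.
  apply/eqP; rewrite eqn_leq pQ andbT leqNgt -sg; apply/negP => sgQ.
  (* Degrees above p are excluded by g itself: y is a root of g, so epsilon of g is infinite. *)
  have := keyQ g g0 sgQ; apply/negP; rewrite -leNgt.
  apply: le_trans (eps_ge g0 (_ : root _ y)); last by rewrite /root g_y.
  by rewrite subrr val0 le_PInf.
by split=> //; apply/(closeP Qm sQ'); exists c.
Qed.

Local Notation Psi := (Psi iota nubar).

Lemma Psi1E Q : Psi 1 Q <-> exists b, Q = X_ b.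
Proof.
split=> [[/key_polyE[[b ->]|[_ sQ _]] sQ1]|[b ->]].
- by exists b.
- by have := prime_gt1 pp; rewrite -ltnS -sQ sQ1.
- by split; [apply: key_XsubC|rewrite size_XsubC].
Qed.

Lemma plateauE n : plateau nu iota nubar n <-> n = 1%N.
Proof.
split=> [[[Q [/key_polyE kQ sQ]] nm]|->].
  case: kQ sQ => [[b ->]|[Qm sQ oQ]]; first by rewrite size_XsubC => -[].
  (* In degree p the maximum is attained by g, whose value is infinite. *)
  rewrite sQ => -[np]; case: nm; exists g.
    by have [gm sg og] := limit_poly_g; rewrite -np; split=> //; apply/key_polyE; right.
  by move=> Q' _; rewrite [leRHS]nuE g_y val0 le_PInf.
split; first by exists (X_ 0); apply/Psi1E; exists 0.
move=> [Q /Psi1E[b ->] h]; have [b' bb'] := nomax b.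
have : nu (X_ b') <= nu (X_ b) by apply: h; apply/Psi1E; exists b'.
by rewrite !nu_XsubC Fin_le => /(lt_le_trans bb'); rewrite ltxx.
Qed.

Lemma limit_keyE F : limit_key_poly nu iota nubar 1 F <-> limit_poly F.
Proof.
have p2 := prime_gt1 pp; split=> [[_ [/key_polyE[[b ->]|//] + _]]|lF].
  by rewrite size_XsubC.
split; first exact/plateauE.
have [_ sF _] := lF; split; first by apply/key_polyE; right.
  by rewrite sF ltnS.
by move=> F' /key_polyE[[b ->]|[_ -> _]]; rewrite ?size_XsubC // sF.
Qed.

Lemma eventuallyE P : eventually nu iota nubar 1 P <-> ev_close (fun b => P (X_ b)).
Proof.
split=> [[Q0 /Psi1E[b0 ->] h]|[b0 h]].
  by exists b0 => b bb; apply: h; [apply/Psi1E; exists b|rewrite !nu_XsubC].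
exists (X_ b0); first by apply/Psi1E; exists b0.
by move=> _ /Psi1E[b ->]; rewrite !nu_XsubC; apply: h.
Qed.

Lemma bounded_Psi1 : bounded_in nu iota nubar 1.
Proof. by have [M hM] := bnd; exists M => _ /Psi1E[b ->]; rewrite nu_XsubC Fin_le. Qed.

Lemma qcoef_XsubC (h : {poly K}) b i :
  qcoef (X_ b) h i = ((h \Po ('X + b%:P))`_i)%:P.
Proof.
have [ih|ih] := ltnP i (size h); last first.
  rewrite qcoef_eq0 ?monicXsubC ?size_XsubC //; apply/esym/eqP.
  by rewrite polyC_eq0 nth_default // size_comp_poly2 ?size_XaddC.
apply/esym; apply: (@qcoef_unique _ (X_ b) (monicXsubC b) h (size h)
   (fun i => ((h \Po ('X + b%:P))`_i)%:P)) => //.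
  by move=> k; rewrite size_XsubC ltnS size_polyC leq_b1.
set H := h \Po _; have sH : size H = size h by rewrite size_comp_poly2 ?size_XaddC.
have hE : h = H \Po X_ b.
  by rewrite -comp_polyA comp_polyD comp_polyX comp_polyC subrK comp_polyXr.
by rewrite {1}hE comp_polyE sH; apply: eq_bigr => k _; rewrite mul_polyC.
Qed.


(** * The valuation attached to x - b and the defect of the plateau *)

Section GaussAt.
Variable b : K.

(** Under X -> [z b] X + b, the coefficient at X^i becomes the Taylor coefficient at b times
    [z b ^+ i], whose value is that of the i-th term of the (x - b)-expansion. This exhibits [nuQ]
    as a pulled back Gauss valuation. *)
Definition gauss_at : valuation {poly K} G :=
  comap (comp_poly (z b *: 'X + (iota b)%:P) \o map_poly iota) (gauss_val w).

Lemma gauss_at_coef (h : {poly K}) i :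
  (fm h \Po (z b *: 'X + (iota b)%:P))`_i = iota (h \Po ('X + b%:P))`_i * z b ^+ i.
Proof.
have -> : z b *: 'X + (iota b)%:P = ('X + (iota b)%:P) \Po (z b *: 'X).
  by rewrite comp_polyD comp_polyX comp_polyC.
rewrite comp_polyA coef_comp_scaleX -coef_map map_comp_poly.
by rewrite rmorphD /= map_polyX map_polyC.
Qed.

Lemma gauss_at_polyC c : gauss_at c%:P = w (iota c).
Proof.
rewrite -(gaussZXn w (iota c) 0); congr (gauss w _).
by rewrite /= map_polyC comp_polyC expr0 alg_polyC.
Qed.

Lemma gauss_at_XsubC : gauss_at (X_ b) = Fin (cv b).
Proof.
rewrite -cvE -(gaussZXn w (z b) 1); congr (gauss w _).
by rewrite /= rmorphB /= map_polyX map_polyC comp_polyB comp_polyX comp_polyC addrK expr1.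
Qed.

Lemma nu_monomial c i : nu (c%:P * X_ b ^+ i) = w (iota c * z b ^+ i).
Proof.
rewrite nuE rmorphM rmorphXn rmorphB /= map_polyX !map_polyC hornerM hornerC.
by rewrite horner_exp hornerXsubC.
Qed.

Lemma gauss_atE (h : {poly K}) : gauss_at h = nuQ nu (X_ b) h.
Proof.
apply: le_anti; apply/andP; split.
  apply: le_bigmin => [|i _]; first exact: le_PInf.
  by rewrite qcoef_XsubC nu_monomial -gauss_at_coef; apply: gauss_le.
apply/le_gauss => i; rewrite gauss_at_coef; have [->|Hi0] := eqVneq (h \Po ('X + b%:P))`_i 0.
  by rewrite rmorph0 mul0r Defs.val0 le_PInf.
have ih : (i < size h)%N.
  rewrite ltnNge; apply: contraNN Hi0 => hi; apply/eqP/nth_default.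
  by rewrite size_comp_poly2 ?size_XaddC.
have qi0 : qcoef (X_ b) h (Ordinal ih) != 0 by rewrite qcoef_XsubC polyC_eq0.
apply: le_trans (bigmin_le_cond (j := Ordinal ih) _ _ qi0) _.
by rewrite qcoef_XsubC nu_monomial.
Qed.

(** The roots of F are close, hence all at value exactly cv b from b; up to sign, the i-th Taylor
    coefficient is a symmetric function of degree p - i in the differences. *)
Lemma limit_poly_coef_ge F i : limit_poly F -> (i <= p)%N ->
  Fin (cv b *+ (p - i)) <= gauss_at ((F \Po ('X + b%:P))`_i)%:P.
Proof.
move=> /limit_poly_close[s sE [ss sc]] ip; rewrite gauss_at_polyC -(val_FinX _ (cvE b)).
rewrite -(val_le2r _ _ _ (expf_neq0 i (z_neq0 b))) -exprD subnK // -coef_map map_comp_poly.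
rewrite rmorphD /= map_polyX map_polyC /= sE comp_prod.
rewrite -[in leLHS]ss -[size s](size_map (fun c => c - iota b)).
apply: coef_prod_close => _ /mapP[d /sc dc ->].
by rewrite [w (d - _)]valB val_sub_close // cvE.
Qed.

Lemma coef_ring_part (Q f : {poly K}) c : (size f < size Q)%N -> Fin c <= gauss_at f ->
  coef_ring (mu := gauss_at) Q (gr_part gauss_at c f).
Proof.
move=> fQ; rewrite le_eqVlt => /orP[/eqP fc S [S0 Sb] hS|cf S [S0 _] _].
  by rewrite -gr_inE //; apply: hS.
by rewrite gr_part0.
Qed.

Lemma degQ_lim F : limit_poly F -> degQ_is nu (X_ b) F p.
Proof.
move=> lF; exists gauss_at; split; first exact: gauss_atE.
pose H := F \Po ('X + b%:P); have [_ sF _] := lF.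
have Hp : H`_p = 1.
  apply: (fmorph_inj iota); rewrite -coef_map map_comp_poly rmorphD /= map_polyX map_polyC rmorph1.
  have [s -> [<- _]] := limit_poly_close lF; rewrite comp_prod.
  have /monicP := monic_prod_XsubC [seq c - iota b | c <- s] xpredT id.
  by rewrite lead_coefE size_prod_XsubC size_map.
(* All terms have value at least p cv b, and the monic one attains it. Components of prescribed
   degree are taken because a lower term may have larger value, and must then contribute 0 instead
   of its initial form. *)
exists (\poly_(i < p.+1) gr_part gauss_at (cv b *+ (p - i)) (H`_i)%:P); split.
- move=> i; rewrite coef_poly; case: ifP => [|_ S [S0 _] _ //]; rewrite ltnS => ip.
  apply: coef_ring_part; last exact: limit_poly_coef_ge.
  by rewrite size_XsubC ltnS size_polyC leq_b1.
- have FE : F = \sum_(i < p.+1) (H`_i)%:P * X_ b ^+ i.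
    rewrite {1}(@qcoefE _ (X_ b) (monicXsubC b) _ F) ?size_XsubC // sF.
    by apply: eq_bigr => i _; rewrite qcoef_XsubC.
  have leX i : Fin (cv b *+ i) <= gauss_at (X_ b ^+ i).
    elim: i => [|i IH]; first by rewrite Defs.val1.
    by rewrite exprS mulrS Defs.valM; apply: ext_leD => //; rewrite gauss_at_XsubC.
  have leT (i : 'I_p.+1) : Fin (cv b *+ p) <= gauss_at ((H`_i)%:P * X_ b ^+ i).
    rewrite Defs.valM -{1}(@subnK i p) -1?ltnS // mulrnDr; apply: ext_leD => //.
    by apply: limit_poly_coef_ge; rewrite // -ltnS.
  have muF : gauss_at F = Fin (cv b *+ p).
    apply: le_anti; apply/andP; split.
      apply: le_trans (gauss_le _ _ p) _; rewrite /= gauss_at_coef -/H Hp rmorph1 mul1r.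
      by rewrite (val_FinX _ (cvE b)).
    by rewrite FE; apply: val_sum_ge => i _ _.
  rewrite (gr_inE muF) {1}FE gr_part_sum => [|i _]; last exact: leT.
  rewrite horner_poly; apply: eq_bigr => i _.
  rewrite (gr_inE gauss_at_XsubC) gr_partX ?gauss_at_XsubC // gr_partM //; last first.
    by apply: limit_poly_coef_ge; rewrite // -ltnS.
  by rewrite -mulrnDr subnK // -ltnS.
- by rewrite size_poly_eq // subnn mulr0n Hp gr_part1 oner_neq0.
Qed.

End GaussAt.

Lemma defect_Psi1 : plateau_defect_is nu iota nubar 1 p.
Proof.
split; first by exists g; apply/limit_keyE.
move=> F /limit_keyE lF; apply/eventuallyE; exists 0 => b _; exact: degQ_lim.
Qed.

Lemma limit_poly_addr (r : {poly K}) b : (size r <= 2)%N -> exceeds_p (fm (r + X_ b ^+ p)).[y] ->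
  limit_poly (r + X_ b ^+ p).
Proof.
move=> sr; have sX : size (X_ b ^+ p) = p.+1 by rewrite size_exp_XsubC.
have rX : (size r < size (X_ b ^+ p)%R)%N.
  by rewrite sX ltnS (leq_trans sr) // prime_gt1.
split=> //; last by rewrite addrC size_polyDl.
by rewrite monicE lead_coefDr // -monicE monic_exp ?monicXsubC.
Qed.

(** * The set attached to the plateau *)

Local Notation pset_prop := (plateau_set_prop nu iota nubar p 1).

Lemma pset_prop0 : pset_prop (@finset.set0 'I_1) <-> exceeds_pred (T g)`_1.
Proof.
split=> [h|ab F /limit_keyE lF].
  apply/(exceeds_predE limit_poly_g); have /eventuallyE := h g (proj2 (limit_keyE g) limit_poly_g).
  apply: ev_close_imp => b [_ /limit_keyE[_ _]].
  by rewrite finset.big_set0 addr0 qcoef_XsubC shift0 expn1.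
apply/eventuallyE; apply: ev_close_imp (proj1 (exceeds_predE lF) (exceeds_pred_lim lF limit_poly_g ab)) => b ob.
split=> [i|]; first by rewrite finset.in_set0.
rewrite finset.big_set0 addr0 qcoef_XsubC shift0 expn1; apply/limit_keyE.
by apply: limit_poly_addr; rewrite // size_polyC; case: (_ != 0).
Qed.

Lemma pset_propT : ~ exceeds_pred (T g)`_1 -> pset_prop (@finset.setTfor 'I_1).
Proof.
move=> nab F /limit_keyE lF; apply/eventuallyE.
(* F' = 0 would give [exceeds_pred] for F, hence for g. So F' is nonzero of degree < p, and
   a_{Q1}(F) = F'(b) does not vanish for b near y. *)
have D0 : F^`() != 0.
  by apply/eqP => /(exceeds_pred_deriv0 lF) aF; apply: nab; apply: exceeds_pred_lim aF.
have sD : (size F^`() <= p)%N.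
  by have [_ sF _] := lF; apply: leq_trans (size_poly _ _) _; rewrite sF.
apply: ev_close_imp (ev_close_and (ev_close_neq0 D0 sD) (exceeds_p_trunc1 lF)) => b [Db ob].
split=> [i _|]; first by rewrite ord1 expn0 qcoef_XsubC shift1 polyC_eq0.
rewrite (big_pred1 ord0) => [|i]; last by rewrite finset.in_setT /= [i]ord1 eqxx.
rewrite expn0 expn1 expr1 !qcoef_XsubC shift0 shift1; apply/limit_keyE.
apply: limit_poly_addr => //; apply: leq_trans (size_polyD _ _) _.
rewrite geq_max size_polyC; case: (_ != 0) => //=.
  by rewrite mul_polyC; apply: leq_trans (size_scale_leq _ _) _; rewrite size_XsubC.
by rewrite mul_polyC; apply: leq_trans (size_scale_leq _ _) _; rewrite size_XsubC.
Qed.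

Lemma plateau_setP : exists I1 : {set 'I_1}, is_plateau_set nu iota nubar p 1 I1 /\
  (I1 = finset.set0 <-> exceeds_pred (T g)`_1).
Proof.
have [ab|nab] := pselect (exceeds_pred (T g)`_1).
  exists finset.set0; split=> //; split; first exact/pset_prop0.
  by move=> J _; apply: finset.sub0set.
exists (@finset.setTfor 'I_1); split; last first.
  by split=> // e; have := finset.in_setT (ord0 : 'I_1); rewrite e finset.in_set0.
split; first exact: pset_propT.
move=> J hJ; have [J0|[i iJ]] := finset.set_0Vmem J.
  by case: nab; apply/pset_prop0; rewrite -J0.
by apply/fintype.subsetP => k _; rewrite [k]ord1 -(ord1 i).
Qed.

End Core.

(** * Extension of partial isomorphisms of the algebraic closure *)

Section PartialIsomorphism.
Local Open Scope classical_set_scope.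
Local Open Scope ring_scope.
Variable Omega : closedFieldType.
Implicit Types (x y z : Omega) (c d : Omega * Omega).

(* The graphs of the isomorphisms between subfields of [Omega]. *)
Definition iso_graph (R : set (Omega * Omega)) : Prop :=
  [/\ R 1, forall c d, R c -> R d -> R (c - d), forall c d, R c -> R d -> R (c * d),
      forall c, R c -> R (c.1^-1, c.2^-1) & forall y, R (0, y) -> y = 0].

Record piso := PIso { pset :> set (Omega * Omega); pisoP : iso_graph pset }.

Section GraphField.
Variable r : piso.

Definition graph_pred : {pred Omega * Omega} := fun c => `[< pset r c >].

Fact graph_subring : subring_closed graph_pred.
Proof.
have [r1 rB rM _ _] := pisoP r.
by split=> [|c d /asboolP rc /asboolP rd|c d /asboolP rc /asboolP rd]; apply/asboolP; auto.
Qed.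
HB.instance Definition _ := GRing.isSubringClosed.Build _ graph_pred graph_subring.

(** The graph itself is made a field, isomorphic to the domain and to the image by the two
    projections. One polynomial over it encodes a polynomial over the domain together with its
    transform. *)
Record graph := Graph { graph_val : Omega * Omega; graph_valP : graph_val \in graph_pred }.
HB.instance Definition _ := [isSub for graph_val].
HB.instance Definition _ := [Choice of graph by <:].
HB.instance Definition _ := [SubChoice_isSubComNzRing of graph by <:].

Lemma graphP (a : graph) : pset r (val a).
Proof. exact/asboolP/(valP a). Qed.

Fact graph_inv_subproof (a : graph) : ((val a).1^-1, (val a).2^-1) \in graph_pred.
Proof. by have [_ _ _ rV _] := pisoP r; apply/asboolP/rV/graphP. Qed.
Definition graph_inv a := Graph (graph_inv_subproof a).

Lemma graph_eq0 (a : graph) : (a == 0) = ((val a).1 == 0).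
Proof.
apply/eqP/eqP => [->//|a0]; apply: val_inj.
have [_ _ _ _ r0] := pisoP r; have := graphP a.
by rewrite [val a]surjective_pairing a0 => /r0->.
Qed.

(** Injectivity follows from single-valuedness: otherwise 1 - a a^-1, computed in coordinates, would
    be (0, 1). *)
Lemma graph_snd_eq0 (a : graph) : (val a).2 = 0 -> (val a).1 = 0.
Proof.
move=> a2; apply/eqP/contraT => a1; have [r1 rB rM rV r0] := pisoP r.
have := rB _ _ r1 (rM _ _ (graphP a) (rV _ (graphP a))).
have -> : 1 - val a * ((val a).1^-1, (val a).2^-1) = (0, 1) :> Omega * Omega.
  by rewrite [LHS]surjective_pairing /= a2 divff // mul0r subrr subr0.
by move=> /r0/eqP; rewrite oner_eq0.
Qed.

Fact graph_mulVf (a : graph) : a != 0 -> graph_inv a * a = 1.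
Proof.
rewrite graph_eq0 => a0; apply: val_inj; rewrite rmorphM rmorph1 /=.
have a2 : (val a).2 != 0 by apply: contraNneq a0 => /graph_snd_eq0->.
by rewrite [LHS]surjective_pairing /= !mulVf.
Qed.

Fact graph_inv0 : graph_inv 0 = 0.
Proof. by apply: val_inj; rewrite /= !invr0. Qed.

HB.instance Definition _ := GRing.ComNzRing_isField.Build graph graph_mulVf graph_inv0.

Definition gfst : {rmorphism graph -> Omega} := fst \o val.
Definition gsnd : {rmorphism graph -> Omega} := snd \o val.

End GraphField.

Section Extension.
Variables (r : piso) (z z' : Omega) (m : {poly graph r}).
Hypothesis m0 : m != 0.
Hypothesis mz : root (map_poly (gfst r) m) z.
Hypothesis m_min : forall q : {poly graph r}, q != 0 -> root (map_poly (gfst r) q) z ->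
  (size m <= size q)%N.
Hypothesis mz' : root (map_poly (gsnd r) m) z'.

Definition ext_eval (q : {poly graph r}) : Omega * Omega :=
  ((map_poly (gfst r) q).[z], (map_poly (gsnd r) q).[z']).

Definition ext_set : set (Omega * Omega) := [set ext_eval q | q in setT].

Lemma min_dvd (q : {poly graph r}) : root (map_poly (gfst r) q) z -> m %| q.
Proof.
move=> qz; apply/modp_eq0P/eqP/contraT => qm0.
have : (size (q %% m)%R < size m)%N by rewrite ltn_modp.
rewrite ltnNge m_min //; move: qz; rewrite {1}(divp_eq q m) /root rmorphD rmorphM /=.
by rewrite hornerD hornerM (eqP mz) mulr0 add0r.
Qed.

Lemma min_coprime (q : {poly graph r}) : ~~ root (map_poly (gfst r) q) z -> coprimep q m.
Proof.
move=> qz; have [e mE] := dvdpP _ _ (dvdp_gcdr q m).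
have d0 : gcdp q m != 0 by rewrite gcdp_eq0 negb_and m0 orbT.
have e0 : e != 0 by apply: contraNneq m0 => e0; rewrite mE e0 mul0r.
rewrite /coprimep; move: mz; rewrite {1}mE rmorphM rootM => /orP[ez|dz].
  have dgt0 : (0 < size (gcdp q m))%N by rewrite size_poly_gt0.
  have := m_min e0 ez; rewrite {1}mE size_mul // -(prednK dgt0) addnS /=.
  by rewrite -{2}[size e]addn0 leq_add2l leqn0 => /eqP->.
have [h qE] := dvdpP _ _ (dvdp_gcdl q m).
by move: qz; rewrite {1}qE rmorphM rootM dz orbT.
Qed.

Lemma ext_evalM q q' : ext_eval (q * q') = ext_eval q * ext_eval q'.
Proof. by rewrite /ext_eval !rmorphM /= !hornerM. Qed.

Lemma ext_evalB q q' : ext_eval (q - q') = ext_eval q - ext_eval q'.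
Proof. by rewrite /ext_eval !rmorphB /= !hornerD !hornerN. Qed.

Lemma ext_eval1 : ext_eval 1 = 1.
Proof. by rewrite /ext_eval !rmorph1 !hornerC. Qed.

Lemma ext_eval_dvd q : m %| q -> ext_eval q = 0.
Proof.
move=> /dvdpP[h ->]; rewrite ext_evalM.
by rewrite [ext_eval m](_ : _ = 0) ?mulr0 // /ext_eval (eqP mz) (eqP mz').
Qed.

(** Single-valuedness: if q(z) = 0 then m divides q, and the transform of q vanishes at z'. Inverses
    come from a Bezout relation with m. *)
Lemma ext_set_graph : iso_graph ext_set.
Proof.
split.
- by exists 1 => //; exact: ext_eval1.
- by move=> _ _ [q _ <-] [q' _ <-]; exists (q - q') => //; exact: ext_evalB.
- by move=> _ _ [q _ <-] [q' _ <-]; exists (q * q') => //; exact: ext_evalM.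
- move=> _ [q _ <-]; have [qz|qz] := boolP (root (map_poly (gfst r) q) z).
    rewrite (ext_eval_dvd (min_dvd qz)) /= invr0; exists 0 => //.
    by rewrite /ext_eval !rmorph0 !horner0.
  have [u uq] := Bezout_eq1_coprimepP _ _ (min_coprime qz).
  exists u.1 => //; have := congr1 ext_eval uq.
  rewrite -[u.2 * m]opprK ext_evalB -[- (u.2 * m)]mulNr (ext_eval_dvd (dvdp_mulIr _ _)) subr0.
  rewrite ext_evalM ext_eval1; case: (ext_eval u.1) (ext_eval q) => a b [c d] [ac bd] /=.
  by rewrite (mulr1_eq (etrans (mulrC c a) ac)) (mulr1_eq (etrans (mulrC d b) bd)).
move=> y [q _ [qz <-]]; have /ext_eval_dvd[] // : m %| q.
by apply: min_dvd; apply/eqP.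
Qed.

Lemma sub_ext_set : pset r `<=` ext_set.
Proof.
move=> c rc; have cr : c \in graph_pred r by apply/asboolP.
by exists (Graph cr)%:P => //; rewrite /ext_eval !map_polyC !hornerC; case: c rc cr.
Qed.

Lemma ext_set_gen : ext_set (z, z').
Proof. by exists 'X => //; rewrite /ext_eval !map_polyX !hornerX. Qed.

End Extension.

Section Total.
Variables (K : fieldType) (iota : {rmorphism K -> Omega}).
Hypothesis alg : forall z, algebraicOver iota z.

Lemma lift_poly (r : piso) (q : {poly K}) : (forall b, pset r (iota b, iota b)) ->
  exists q' : {poly graph r}, map_poly (gfst r) q' = map_poly iota q.
Proof.
move=> rK; have Kr b : (iota b, iota b) \in graph_pred r by apply/asboolP.
exists (\poly_(i < size q) (Graph (Kr q`_i))).
apply/polyP => i; rewrite !coef_map coef_poly; case: ltnP => // iq.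
rewrite [q`_i]nth_default //; exact: etrans (rmorph0 _) (esym (rmorph0 _)).
Qed.

Lemma min_poly_exists (r : piso) z : (forall b, pset r (iota b, iota b)) ->
  exists m : {poly graph r}, [/\ m != 0, root (map_poly (gfst r) m) z &
    forall q : {poly graph r}, q != 0 -> root (map_poly (gfst r) q) z ->
      (size m <= size q)%N].
Proof.
move=> rK; pose P n := `[< exists q : {poly graph r},
  [/\ q != 0, root (map_poly (gfst r) q) z & size q = n] >].
have [n0 Pn0] : exists n, P n.
  have [q q0 qz] := alg z; have [q' qq'] := lift_poly q rK.
  exists (size q'); apply/asboolP; exists q'; split=> //; last by rewrite qq'.
  by rewrite -(map_poly_eq0 (gfst r)) qq' map_poly_eq0.
case: (@ex_minnP P (ex_intro (fun n => is_true (P n)) n0 Pn0)) => n /asboolP[m [m0 mz mn]] nmin.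
exists m; split=> // q q0 qz; rewrite mn; apply: nmin; apply/asboolP; by exists q.
Qed.

(** By Zorn's lemma. A maximal partial isomorphism is total: the transform of the minimal polynomial
    of z has a root in [Omega], to which z can be sent. *)
Lemma piso_total (r0 : piso) : (forall b, pset r0 (iota b, iota b)) ->
  exists r : piso, pset r0 `<=` pset r /\ forall z, exists z', pset r (z, z').
Proof.
move=> r0K; pose T := {r : piso | `[< pset r0 `<=` pset r >]}.
have r00 : `[< pset r0 `<=` pset r0 >] by apply/asboolP.
pose R (s t : T) := `[< pset (sval s) `<=` pset (sval t) >].
have [|||t tmax] := @ZL_preorder T (exist _ r0 r00) R.
- by move=> t; apply/asboolP.
- by move=> a b c /asboolP ab /asboolP bc; apply/asboolP => x /ab/bc.
- move=> A Atot; have [[a Aa]|A0] := pselect (exists a, A a); last first.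
    by exists (exist _ r0 r00) => s As; case: A0; exists s.
  pose U := [set c | exists2 s, A s & pset (sval s) c].
  have join c d : U c -> U d -> exists s, [/\ A s, pset (sval s) c & pset (sval s) d].
    move=> [s As sc] [t At td]; have [/asboolP st|/asboolP ts] := Atot _ _ As At.
      by exists t; split=> //; apply: st.
    by exists s; split=> //; apply: ts.
  have UG : iso_graph U.
    split.
    - by exists a => //; case: (pisoP (sval a)).
    - move=> c d Uc Ud; have [s [As sc sd]] := join _ _ Uc Ud; exists s => //.
      by case: (pisoP (sval s)) => _ sB _ _ _; apply: sB.
    - move=> c d Uc Ud; have [s [As sc sd]] := join _ _ Uc Ud; exists s => //.
      by case: (pisoP (sval s)) => _ _ sM _ _; apply: sM.
    - by move=> c [s As sc]; exists s => //; case: (pisoP (sval s)) => _ _ _ sV _; apply: sV.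
    - by move=> y [s As]; case: (pisoP (sval s)) => _ _ _ _ s0 /s0.
  have r0U : `[< pset r0 `<=` pset (PIso UG) >].
    by apply/asboolP => c rc; exists a => //; move/asboolP: (svalP a); apply.
  by exists (exist _ (PIso UG) r0U) => s As; apply/asboolP => c sc; exists s.
have /asboolP r0t := svalP t; exists (sval t); split=> // z.
have [m [m0 mz m_min]] := min_poly_exists z (fun b => r0t _ (r0K b)).
have ms : size (map_poly (gsnd (sval t)) m) != 1%N.
  rewrite size_map_poly -(size_map_poly (gfst (sval t))).
  by apply/eqP => /eqP/size_poly1P[c c0 e]; move: mz; rewrite e rootC (negPf c0).
have [z' mz'] := closed_rootP _ ms.
have rU : `[< pset r0 `<=` pset (PIso (ext_set_graph m0 mz m_min mz')) >].
  by apply/asboolP => c /r0t; apply: sub_ext_set.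
pose t' : T := exist _ (PIso (ext_set_graph m0 mz m_min mz')) rU.
have tt' : R t t' by apply/asboolP; apply: sub_ext_set.
by exists z'; have /asboolP := tmax _ tt'; apply; apply: ext_set_gen.
Qed.

End Total.
End PartialIsomorphism.

(** * Immediate extensions *)

Section Immediate.
Variables (K : fieldType) (L : fieldExtType K) (G : orderedGroupType) (v : valuation L G).
Local Notation vK := (comap (in_alg L) v).
Local Open Scope quotient_scope.

Lemma value_groupB (R : fieldType) (u : valuation R G) g h :
  value_group u g -> value_group u h -> value_group u (g - h).
Proof.
move=> [x xg] [y yh]; have y0 : y != 0 by rewrite -(val_PInf u) yh.
exists (x / y); have := Defs.valM u (x / y) y; rewrite mulfVK // xg yh.
by case: (u (x / y)) => //= k [->]; rewrite addrK.
Qed.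

Lemma index1_value (x : L) : index_is (value_group vK) (value_group v) 1 -> x != 0 ->
  exists c : K, v c%:A = v x.
Proof.
move=> [t [_ ht]] /(val_Fin v)[g xg].
(* The single coset representative need not be 0; comparison with the coset of 0 puts it in vK. *)
have A0 : value_group vK (0 - t ord0).
  have [|i [+ _]] := ht 0; last by rewrite [i]ord1.
  by exists 1; rewrite Defs.val1.
have [|i [+ _]] := ht g; first by exists x.
rewrite [i]ord1 => Ag; have [c /= cg] := value_groupB Ag A0.
by exists c; rewrite [v _]cg xg sub0r opprK subrK.
Qed.

Lemma residue_eq (F : fieldType) (u : valuation F G) (x y : vring_type u) :
  \pi_(residue u) x = \pi_(residue u) y -> Fin 0 < u (val x - val y).
Proof. by move/eqP; rewrite -Quotient.idealrBE inE rmorphB. Qed.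

Lemma residue_subM y z : residue_sub (v := v) y -> residue_sub (v := v) z ->
  residue_sub (v := v) (y * z).
Proof.
move=> [x [b xb] ->] [x' [b' xb'] ->]; exists (x * x'); last by rewrite rmorphM.
by exists (b * b'); rewrite -[RHS]/(in_alg L (b * b')) !rmorphM /= xb xb'.
Qed.

Lemma degree1_residue (x : L) : degree_is (residue_sub (v := v)) setT 1 ->
  Fin 0 <= v x -> exists d : K, Fin 0 < v (x - d%:A).
Proof.
move=> [e [_ he]] x0; have xO : x \in vring v by [].
have dec (y : residue v) : exists2 c, residue_sub c & y = c * e ord0.
  have [c [[cs ->] _]] := he y I; exists (c ord0); first exact: cs.
  by rewrite big_ord_recl big_ord0 addr0.
have [c1 c1s e1] := dec 1; have [c2 c2s e2] := dec (e ord0 * e ord0).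
(* The basis element e need not be 1. From 1 = c1 e and e e = c2 e follows e = c1 e e = c2 (c1 e) =
   c2, so e lies in Kv. *)
have es : residue_sub (e ord0).
  have -> : e ord0 = c2; last by [].
  by rewrite -[LHS]mul1r {1}e1 -mulrA e2 mulrCA -e1 mulr1.
have [c cs cx] := dec (\pi_(residue v) (VRing xO)).
have [x' [d x'd] /esym exx'] := residue_subM cs es.
by exists d; rewrite -x'd; have := residue_eq (etrans cx (esym exx')).
Qed.

End Immediate.

Lemma horner_size2 (R : nzRingType) (P : {poly R}) x :
  size P = 2%N -> P.[x] = P`_0 + P`_1 * x.
Proof.
by move=> sP; rewrite horner_coef sP !big_ord_recl big_ord0 /= expr0 mulr1 expr1 addr0.
Qed.

(** * Degree and conjugates over the henselization *)

Section HenselianDefect.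
Variables (K : fieldType) (L : fieldExtType K) (G : orderedGroupType) (v : valuation L G).
Variables (Omega : closedFieldType) (j : {rmorphism L -> Omega}).
Local Notation iota := (j \o in_alg L).
Hypothesis alg : forall z : Omega, algebraicOver iota z.
Variables (eta : L) (g : {poly K}) (p : nat).
Hypothesis gen : forall x : L, exists q : {poly K}, x = (map_poly (in_alg L) q).[eta].
Hypothesis gmon : g \is monic.
Hypothesis sg : size g = p.+1.
Hypothesis g_eta : (map_poly (in_alg L) g).[eta] = 0.
Hypothesis g'_eta : (map_poly (in_alg L) g^`()).[eta] != 0.
Local Open Scope classical_set_scope.
Local Open Scope ring_scope.

Lemma map_iota (q : {poly K}) : map_poly iota q = map_poly j (map_poly (in_alg L) q).
Proof. by rewrite map_poly_comp. Qed.

Lemma horner_iota (q : {poly K}) : (map_poly iota q).[j eta] = j (map_poly (in_alg L) q).[eta].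
Proof. by rewrite map_iota horner_map. Qed.

Variables (w : valuation Omega G) (Kh Lh : set Omega) (n : nat).
Hypothesis wj : forall x, w (j x) = v x.
Hypothesis hK : is_henselization w (range iota) Kh.
Hypothesis hL : is_henselization w (range j) Lh.
Hypothesis deg : degree_is Kh Lh n.
Hypothesis n_gt1 : (1 < n)%N.

Lemma diag_graph (E : set Omega) : subfield_set E -> iso_graph [set c | E c.1 /\ c.1 = c.2].
Proof.
move=> [E1 EB ED]; have EV x : E x -> E x^-1 by move=> Ex; rewrite -[x^-1]mul1r; apply: ED.
have EM x y : E x -> E y -> E (x * y) by move=> Ex Ey; rewrite -[y]invrK; apply: ED => //; apply: EV.
split; first by split.
- by move=> c d [Ec ce] [Ed de]; split=> /=; [apply: EB|rewrite ce de].
- by move=> c d [Ec ce] [Ed de]; split=> /=; [apply: EM|rewrite ce de].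
- by move=> c [Ec ce]; split=> /=; [apply: EV|rewrite ce].
- by move=> y [_].
Qed.

Let sfK : subfield_set Kh. Proof. by case: hK. Qed.
(** The identity of [Kh] as a partial isomorphism; [graph rK] also provides [Kh] as a field type. *)
Let rK : piso Omega := PIso (diag_graph sfK).

Lemma diag_fst_snd : map_poly (gfst rK) =1 map_poly (gsnd rK).
Proof. by move=> q; apply: eq_map_poly => a; case: (graphP a). Qed.

Lemma Kh_iota b : Kh (iota b).
Proof. by case: hK => _ EK _ _; apply: EK; exists b. Qed.

Lemma rK_iota b : pset rK (iota b, iota b).
Proof. by split=> //; apply: Kh_iota. Qed.

Lemma Kh_gfst (a : graph rK) : Kh (gfst rK a).
Proof. by case: (graphP a). Qed.

(** A field above [Kh] is again henselian, since a valuation agreeing with [w] on it agrees on [Kh].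
    As E contains j(L), minimality of [Lh] applies. *)
Lemma Lh_sub (E : set Omega) : subfield_set E -> Kh `<=` E -> E (j eta) -> Lh `<=` E.
Proof.
move=> sE KE Ee; have [E1 EB ED] := sE.
have E0 : E 0 by rewrite -(subrr 1); apply: EB.
have EN x : E x -> E (- x) by move=> Ex; rewrite -sub0r; apply: EB.
have EA x y : E x -> E y -> E (x + y) by move=> Ex Ey; rewrite -[y]opprK; apply: EB => //; apply: EN.
have EM x y : E x -> E y -> E (x * y).
  by move=> Ex Ey; rewrite -[y]invrK; apply: (ED) => //; rewrite -[y^-1]mul1r; apply: ED.
have [_ _ hens _] := hK; have [_ _ _ minL] := hL; apply: minL => //.
- move=> _ [x _ <-]; have [q ->] := gen x; rewrite -horner_iota.
  elim/poly_ind: q => [|q c IH]; first by rewrite map_poly0 horner0.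
  rewrite rmorphD rmorphM /= map_polyX map_polyC hornerD hornerMX hornerC.
  by apply: EA; [apply: EM|apply/KE/Kh_iota].
- by move=> w' w'E; apply: hens => x /KE/w'E.
Qed.

Lemma Kh_sub_Lh : Kh `<=` Lh.
Proof.
have [_ _ _ minK] := hK; have [sL jL hensL _] := hL; apply: minK => //.
by move=> _ [b _ <-]; apply: jL; exists (b%:A).
Qed.

Lemma eta_notin_Kh : ~ Kh (j eta).
Proof.
move=> Ke; have LK : Lh `<=` Kh by apply: Lh_sub.
have [e [eL eU]] := deg.
have K0 : Kh 0 by have [K1 KB _] := sfK; rewrite -(subrr 1); apply: KB.
have L0 : Lh 0 by apply: Kh_sub_Lh.
have [c0 [_ c0U]] := eU 0 L0.
pose i0 : 'I_n := Ordinal (ltnW n_gt1); pose i1 : 'I_n := Ordinal n_gt1.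
have uniq0 (c : {ffun 'I_n -> Omega}) : (forall i, Kh (c i)) -> 0 = \sum_i c i * e i -> forall i, c i = 0.
  move=> cK cs i; have <- : c0 = c by apply: c0U.
  suff -> : c0 = [ffun=> 0] by rewrite ffunE.
  apply: c0U; split=> [k|]; first by rewrite ffunE.
  by rewrite big1 // => k _; rewrite ffunE mul0r.
(* Were [Lh] inside [Kh], the trivial identity e1 e0 - e0 e1 = 0 would be a linear relation over
   [Kh], forcing e1 = 0, which contradicts freeness in turn. *)
have e1 : e i1 = 0.
  have := uniq0 [ffun i => if i == i0 then e i1 else if i == i1 then - e i0 else 0].
  move=> /(_ _ _ i0); rewrite ffunE eqxx; apply.
    move=> i; rewrite ffunE; case: ifP => _; first exact: LK.
    case: ifP => _ //; have [_ KB _] := sfK; rewrite -sub0r; apply: KB => //; exact: LK.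
  rewrite (bigD1 i0) // (bigD1 i1) //= big1 ?addr0; last first.
    by move=> i /andP[/negPf i_0 /negPf i_1]; rewrite ffunE i_0 i_1 mul0r.
  by rewrite !ffunE !eqxx /= mulNr mulrC subrr.
suff : (1 : Omega) = 0 by move/eqP; rewrite oner_eq0.
have := uniq0 [ffun i => if i == i1 then 1 else 0].
move=> /(_ _ _ i1); rewrite ffunE eqxx; apply.
  by move=> i; rewrite ffunE; case: ifP => // _; case: sfK.
rewrite big1 // => i _; rewrite ffunE; case: eqP => [->|_]; rewrite ?mul0r //.
by rewrite e1 mulr0.
Qed.

(** [Lh] lies in Kh[eta], where remainders modulo the minimal polynomial have degree < p; more than
    p of them are linearly dependent over [Kh]. *)
Lemma rank_le : (n <= p)%N.
Proof.
have [m [m0 mz m_min]] := min_poly_exists alg (j eta) rK_iota.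
have mz' : root (map_poly (gsnd rK) m) (j eta) by rewrite -diag_fst_snd.
have [_ SB SM SV _] := ext_set_graph m0 mz m_min mz'.
pose S := [set x | exists q : {poly graph rK}, x = (map_poly (gfst rK) q).[j eta]].
have extE q : ext_eval (j eta) (j eta) q =
    ((map_poly (gfst rK) q).[j eta], (map_poly (gfst rK) q).[j eta]).
  by rewrite /ext_eval -diag_fst_snd.
have sS : subfield_set S.
  split; first by exists 1; rewrite rmorph1 hornerC.
    by move=> _ _ [q ->] [q' ->]; exists (q - q'); rewrite rmorphB hornerD hornerN.
  move=> _ _ [q ->] [q' ->].
  have [q'' _ /esym] := SV _ (ex_intro2 _ _ q' I erefl); rewrite !extE => -[/= eq _].
  by exists (q * q''); rewrite eq rmorphM hornerM.
have LS : Lh `<=` S.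
  apply: Lh_sub => //; last by exists 'X; rewrite map_polyX hornerX.
  move=> x Kx; have xr : (x, x) \in graph_pred rK by apply/asboolP.
  by exists (Graph xr)%:P; rewrite map_polyC hornerC.
have sm : (size m <= p.+1)%N.
  have [g' gg'] := lift_poly g rK_iota; rewrite -sg -(size_map_poly iota) -gg'.
  rewrite size_map_poly; apply: m_min.
    by rewrite -(map_poly_eq0 (gfst rK)) gg' map_poly_eq0 monic_neq0.
  by rewrite gg' /root horner_iota g_eta rmorph0.
have [e [eL eU]] := deg; rewrite leqNgt; apply/negP => pn.
have q_ex i : exists q : {poly graph rK}, (size q <= p)%N /\ e i = (map_poly (gfst rK) q).[j eta].
  have [q eq] := LS _ (eL i); exists (q %% m); split.
    by rewrite -ltnS; apply: leq_trans sm; rewrite ltn_modp.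
  by rewrite eq {1}(divp_eq q m) rmorphD rmorphM hornerD hornerM (eqP mz) mulr0 add0r.
have [q hq] := choice q_ex.
pose C : 'M[graph rK]_(n, p) := \matrix_(i, k) (q i)`_k.
have : kermx C != 0.
  by rewrite kermx_eq0 /row_free neq_ltn (leq_ltn_trans (rank_leq_col C) pn).
move=> /rowV0Pn[u /sub_kermxP uC /negP]; apply.
have uq : \sum_i u 0 i *: q i = 0.
  apply/polyP => k; rewrite coef_sum coef0; have [kp|kp] := ltnP k p.
    have := congr1 (fun M : 'rV_p => M 0 (Ordinal kp)) uC; rewrite !mxE => uC'.
    by rewrite -[RHS]uC'; apply: eq_bigr => i _; rewrite coefZ !mxE.
  by rewrite big1 // => i _; rewrite coefZ nth_default ?mulr0 // (leq_trans (hq i).1).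
have L0 : Lh 0 by apply: Kh_sub_Lh; have [K1 KB _] := sfK; rewrite -(subrr 1); apply: KB.
have [c0 [_ c0U]] := eU 0 L0.
have c0E : c0 = [ffun=> 0].
  apply: c0U; split=> [k|]; first by rewrite ffunE; have [K1 KB _] := sfK; rewrite -(subrr 1); apply: KB.
  by rewrite big1 // => k _; rewrite ffunE mul0r.
apply/eqP/rowP => i; rewrite mxE; apply: (fmorph_inj (gfst rK)); rewrite rmorph0.
suff : c0 = [ffun i => gfst rK (u 0 i)].
  by move=> /ffunP/(_ i); rewrite c0E !ffunE.
apply: c0U; split=> [k|]; first by rewrite ffunE; apply: Kh_gfst.
have uq0 : (map_poly (gfst rK) (\sum_i u 0 i *: q i)).[j eta] = 0 by rewrite uq map_poly0 horner0.
rewrite -[LHS]uq0 rmorph_sum horner_sum.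
apply: eq_bigr => k _; rewrite ffunE (hq k).2.
by rewrite -[LHS]/((map_poly (gfst rK) (u 0 k *: q k)).[j eta]) map_polyZ hornerZ.
Qed.

(** A conjugate z' of z = [j eta] over [Kh] gives an embedding tau of [Omega] into itself with tau z
    = z'. The valuation w o tau agrees with w on [Kh], hence everywhere, so z and z' are equally far
    from every b, and w(z' - z) is a bound. *)
Lemma dist_bounded : exists M : G, forall b, v (eta - b%:A) <= Fin M.
Proof.
have [m [m0 mz m_min]] := min_poly_exists alg (j eta) rK_iota.
have [q mE] := factor_theorem _ _ mz; set z := j eta in mz mE m_min *.
have mgt : (2 < size m)%N.
  rewrite ltnNge; apply/negP => sm2; apply: eta_notin_Kh.
  have m1 : size m != 1%N.
    by apply/eqP => /eqP/size_poly1P[c c0 e]; move: mz; rewrite e map_polyC rootC fmorph_eq0 (negPf c0).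
  have sm : size m = 2%N.
    by apply/eqP; rewrite eqn_leq sm2 ltn_neqAle eq_sym m1 size_poly_gt0.
  have l0 : m`_1 != 0 by have := lead_coef_eq0 m; rewrite lead_coefE sm => ->.
  have := eqP mz; rewrite horner_size2 ?size_map_poly // !coef_map => /eqP; rewrite addrC addr_eq0 => /eqP e.
  have -> : j eta = gfst rK (- m`_0 / m`_1).
    by rewrite fmorph_div rmorphN -e mulrC mulKf // fmorph_eq0.
  exact: Kh_gfst.
have q0 : q != 0 by apply: contraNneq m0 => q0; rewrite -(map_poly_eq0 (gfst rK)) mE q0 mul0r.
have sq : size q != 1%N.
  apply/eqP => sq; move: mgt; rewrite -(size_map_poly (gfst rK)) mE.
  by rewrite size_mul ?polyXsubC_eq0 // size_XsubC sq.
have [z' qz'] := closed_rootP _ sq.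
(* Separability: otherwise z is a double root of m, and m divides g, so that g'(eta) = 0. *)
have zz' : z' != z.
  apply: contraNneq g'_eta => zz'; rewrite -(fmorph_eq0 j) -horner_iota -deriv_map.
  have [g' gg'] := lift_poly g rK_iota.
  have : m %| g'.
    by apply: (min_dvd m0 mz m_min); rewrite ?gg' // /root horner_iota g_eta rmorph0.
  move=> /dvdpP[h g'E]; have hm := rmorphM (map_poly (gfst rK)) h m.
  rewrite -gg' g'E [map_poly _ _]hm [X in _ * X]mE mulrA derivM hornerD !hornerM.
  rewrite hornerXsubC subrr mulr0 add0r derivXsubC hornerC mulr1.
  by rewrite -[j eta]/z -zz' (eqP qz') mulr0.
have mz' : root (map_poly (gsnd rK) m) z' by rewrite -diag_fst_snd mE rootM qz'.
pose r1 := PIso (ext_set_graph m0 mz m_min mz').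
have r1K b : pset r1 (iota b, iota b) by apply: sub_ext_set; apply: rK_iota.
have [r [r1r tot]] := piso_total alg r1K.
have [_ rB rM _ r0] := pisoP r.
have rfun x y y' : pset r (x, y) -> pset r (x, y') -> y = y'.
  move=> xy xy'; apply/eqP; rewrite -subr_eq0; apply/eqP/r0.
  by have := rB _ _ xy xy'; rewrite [_ - _](_ : _ = (0, y - y')) // -[0](subrr x).
have [tau tauP] := choice tot.
have tauM x y : tau (x * y) = tau x * tau y by apply: (rfun (x * y)) => //; apply: (rM (x, _) (y, _)).
have tauB x y : tau (x - y) = tau x - tau y by apply: (rfun (x - y)) => //; apply: (rB (x, _) (y, _)).
have tau1 : tau 1 = 1 by apply: (rfun 1) => //; case: (pisoP r).
have tau0 : tau 0 = 0 by rewrite -(subrr 1) tauB !subrr.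
have tauD x y : tau (x + y) = tau x + tau y.
  by rewrite -{1}[y]opprK tauB -[- y]sub0r tauB tau0 sub0r opprK.
pose w' : valuation Omega G := @Valuation _ _ (fun x => w (tau x))
  (etrans (congr1 w tau0) (val0 w)) (etrans (congr1 w tau1) (Defs.val1 w))
  (fun x y => etrans (congr1 w (tauM x y)) (Defs.valM w _ _))
  (fun x y => eq_ind_r (fun t => _ <= w t) (Defs.valD w _ _) (tauD x y))
  (fun x => @val_nNInf _ _ w (tau x)).
have [_ _ hens _] := hK.
have tauK x : Kh x -> tau x = x.
  by move=> Kx; apply: (rfun x) => //; apply/r1r/sub_ext_set; split.
have wtau x : w (tau x) = w x by apply: (hens w') => u Ku /=; rewrite tauK.
have tz : tau z = z' by apply: (rfun z) => //; apply/r1r/ext_set_gen.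
have wz b : w (z' - iota b) = v (eta - b%:A).
  rewrite -wj rmorphB -[RHS]wtau tauB -[j eta]/z tz.
  by congr (w (_ - _)); exact/esym/(tauK _ (Kh_iota b)).
have [M wM] : exists M, w (z' - z) = Fin M by apply: val_Fin; rewrite subr_eq0.
exists M => b; rewrite -wM -(subrKA (iota b)); apply: val_leD; first by rewrite wz.
by rewrite valB -wj rmorphB.
Qed.

End HenselianDefect.

(** * Rank one and distance cuts *)

Lemma rank_one_archimedean (G : orderedGroupType) (A : set G) :
  subgroup A -> rank_one A -> divisible_closure A -> archimedean G.
Proof.
move=> [A0 AB] rk [_ dA].
have archA x y : A x -> 0 < x -> A y -> exists n : nat, y < x *+ n.
  move=> Ax x0 Ay; have x0n n : 0 <= x *+ n by rewrite -(mul0rn G n) og_le_MnW // ltW.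
  (* The convex subgroup generated by x is not trivial, hence it is all of A. *)
  pose H : set G := fun h => A h /\ exists n : nat, h <= x *+ n /\ - h <= x *+ n.
  have cH : convex_subgroup A H.
    split; [split| by move=> h []|].
    - by split=> //; exists 0%N; rewrite mulr0n oppr0.
    - move=> h k [Ah [n [h1 h2]]] [Ak [m [k1 k2]]]; split; first exact: AB.
      by exists (n + m)%N; rewrite mulrnDr opprB [k - h]addrC; split; apply: og_leD.
    - move=> h k [_ [n [h1 _]]] Ak /andP[k0 kh]; split=> //; exists n; split.
        exact: le_trans h1.
      by apply: le_trans (x0n n); rewrite -(og_le2l k) subrr addr0.
  have [HA|HA] := pselect (H = A).
    have [_ [n [yn _]]] : H y by rewrite HA.
    exists n.+1; apply: le_lt_trans yn _.
    by rewrite mulrSr -{1}[x *+ n]addr0 og_lt2l.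
  have H0 : H = [set 0]%classic by apply/rk.
  have : H x.
    split=> //; exists 1%N; rewrite mulr1n; split=> //.
    by apply: le_trans (ltW x0); rewrite -(og_le2l x) subrr addr0 ltW.
  by rewrite H0 => xe; move: x0; rewrite xe ltxx.
move=> g h g0; have [m m0 Am] := dA g; have [k k0 Ak] := dA h.
have gm0 : 0 < g *+ m by rewrite -(mul0rn G m) og_lt_Mn.
have [n hn] := archA _ _ Am gm0 Ak.
have [hle|hlt] := boolP (h <= 0); first by exists 1%N; apply: le_lt_trans hle _.
exists (m * n)%N; rewrite mulrnA; apply: le_lt_trans hn.
rewrite -og_ltNge in hlt; rewrite -(prednK k0) mulrS.
by rewrite -{1}[h]addr0 og_le2l -(mul0rn G k.-1) og_le_MnW // ltW.
Qed.

Lemma convex_subgroup_setT (G : orderedGroupType) (H : set G) : archimedean G ->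
  convex_subgroup setT H -> H = [set 0]%classic \/ H = setT.
Proof.
move=> arch [[H0 HB] _ Hc].
have [[h Hh hn0]|nex] := pselect (exists2 h, H h & h != 0); last first.
  left; apply/seteqP; split=> [h Hh|h ->] //=.
  by apply/eqP/contraT => h0; case: nex; exists h.
have HN x : H x -> H (- x) by move=> Hx; rewrite -sub0r; apply: HB.
have [x Hx x0] : exists2 x, H x & 0 < x.
  have [h0|h0] := boolP (0 < h); first by exists h.
  exists (- h); first exact: HN.
  rewrite -og_leNgt in h0; rewrite -(og_lt2l h) subrr addr0 lt_neqAle hn0 //.
have HX n : H (x *+ n).
  by elim: n => // n IH; rewrite mulrS -[x *+ n]opprK; apply: HB => //; apply: HN.
have Hpos y : 0 <= y -> H y.
  move=> y0; have [n yn] := arch x y x0.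
  by apply: (Hc (x *+ n)) => //; rewrite y0 ltW.
right; apply/seteqP; split=> // y _.
have [y0|y0] := orP (og_le_total 0 y); first exact: Hpos.
by rewrite -[y]opprK; apply/HN/Hpos; rewrite -(og_le2l y) subrr addr0.
Qed.

Section Proposition.
Variables (K : fieldType) (L : fieldExtType K) (G : orderedGroupType) (v : valuation L G).
Variables (eta : L) (cv : K -> G).
Hypothesis cvE : forall b, v (eta - b%:A) = Fin (cv b).
Hypothesis arch : archimedean G.
Hypothesis gdiv : forall (n : nat) (g : G), (0 < n)%N -> exists h, h *+ n = g.

Lemma dist_to_baseE x : dist_to_base v eta x <-> exists b, x <= cv b.
Proof.
split=> [[_ [b _ <-]]|[b h]]; first by rewrite cvE Fin_le; exists b.
by exists (v (eta - b%:A)); [exists b|rewrite cvE].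
Qed.

(** The alternative H = G gives an empty cut, whereas the distance contains cv 0. *)
Lemma convex_minusE (H : set G) : convex_subgroup setT H ->
  (exists alpha, dist_to_base v eta = cut_shift alpha (convex_minus H)) ->
  H = [set 0]%classic.
Proof.
move=> /(convex_subgroup_setT arch)[//|->] [alpha e].
have : dist_to_base v eta (cv 0) by apply/dist_to_baseE; exists 0.
rewrite e => -[h hm _]; have := hm (Fin h) (ex_intro2 _ _ h I erefl).
by rewrite ltxx.
Qed.

Lemma cut_shift0 (H : set G) : cut_shift 0 (convex_minus H) = convex_minus H.
Proof.
by apply/seteqP; split=> [_ [x hx <-]|x hx]; [rewrite add0r|exists x; rewrite ?add0r].
Qed.

Lemma convex_minus0 (x : G) : convex_minus [set 0]%classic x <-> x < 0.
Proof.
split=> [h|x0 _ [_ -> <-]]; last by rewrite Fin_ltE.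
by rewrite -Fin_ltE; apply: h; exists 0.
Qed.

(** The factor n, later p - 1, allows comparison with kappa = n alpha without division. *)
Lemma dist_shift (alpha : G) (n : nat) : (0 < n)%N ->
  (exists2 H : set G, convex_subgroup setT H &
     dist_to_base v eta = cut_shift alpha (convex_minus H)) <->
  (forall g : G, (exists b, g <= cv b) <-> g *+ n < alpha *+ n).
Proof.
move=> n0; split=> [[H cH e] g|h].
  have H0 := convex_minusE cH (ex_intro _ alpha e).
  rewrite og_lt_Mn // -dist_to_baseE e H0; split=> [[x /convex_minus0 x0 <-]|ga].
    by rewrite -{2}[alpha]addr0 og_lt2l.
  exists (g - alpha); last by rewrite addrC subrK.
  by apply/convex_minus0; rewrite -(og_lt2r alpha) subrK add0r.
exists [set 0]%classic.
  split=> //; [split=> // x y -> -> /=; exact: subr0|].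
  by move=> _ y -> _ /andP[y0 y1]; apply: le_anti; rewrite y1.
apply/seteqP; split=> g; rewrite dist_to_baseE h og_lt_Mn // => ga.
  exists (g - alpha); last by rewrite addrC subrK.
  by apply/convex_minus0; rewrite -(og_lt2r alpha) subrK add0r.
by case: ga => x /convex_minus0 x0 <-; rewrite -{2}[alpha]addr0 og_lt2l.
Qed.

End Proposition.

(** In characteristic p, (z - 1)^p = z^p - 1 = 0 gives z = 1. This keeps the two alternatives of
    [independent] apart. *)
Lemma prime_root_pchar (K : fieldType) (p : nat) (z : K) :
  prime p -> p.-primitive_root z -> p%:R != 0 :> K.
Proof.
move=> pp zp; apply/negP => p0; have pK : p \in [pchar K] by apply/andP.
have : (z - 1) ^+ p == 0.
  have := pFrobenius_autB_comm pK (commr1 z).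
  by rewrite !pFrobenius_autE expr1n (prim_expr_order zp) subrr => ->.
rewrite expf_eq0 => /andP[_]; rewrite subr_eq0 => /eqP z1.
have := prim_order_dvd zp 1; rewrite z1 expr1n eqxx dvdn1 => /eqP p1.
by rewrite p1 in pp.
Qed.

Lemma nubar_root (Omega : closedFieldType) (G : orderedGroupType)
  (nubar : valuation {poly Omega} G) (P : {poly Omega}) : P \is monic ->
  nubar P = PInf -> exists y, nubar ('X - y%:P) = PInf.
Proof.
move=> Pm; have [s ->] := closed_roots P; rewrite (monicP Pm) scale1r.
elim: s => [|c s IH]; first by rewrite big_nil Defs.val1.
rewrite big_cons Defs.valM; case e: (nubar ('X - c%:P)) => [|g|].
- by case: (@val_nNInf _ _ nubar ('X - c%:P)).
- by move=> h; apply: IH; move: h; case: (nubar _).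
- by exists c.
Qed.

Lemma nubar_horner (Omega : closedFieldType) (G : orderedGroupType)
  (nubar : valuation {poly Omega} G) (y : Omega) : nubar ('X - y%:P) = PInf ->
  forall P, nubar P = comap polyC nubar P.[y].
Proof.
move=> ny P; have /factor_theorem[Q PQ] : root (P - P.[y]%:P) y.
  by rewrite /root hornerD hornerN hornerC subrr.
have nPQ : nubar (P - P.[y]%:P) = PInf.
  by rewrite PQ Defs.valM ny; case: (nubar Q) (@val_nNInf _ _ nubar Q).
rewrite -{1}[P](subrK P.[y]%:P); have [e|e] := eqVneq (nubar P.[y]%:P) PInf.
  by rewrite /= e; apply/eqP; rewrite -PInf_le; apply: val_leD; rewrite ?nPQ ?e.
by rewrite valDr // nPQ lt_neqAle e le_PInf.
Qed.

(** * The Artin-Schreier and Kummer cases *)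

Section Data.
Variables (K : fieldType) (L : fieldExtType K) (G : orderedGroupType) (v : valuation L G).
Variables (p : nat) (eta : L) (a : K).
Hypothesis pp : prime p.
Hypothesis arch : archimedean G.
Hypothesis gdiv : forall (n : nat) (g : G), (0 < n)%N -> exists h, h *+ n = g.
Hypothesis AS_or_Kummer : artin_schreier p eta a \/ (kummer p eta a /\ v a%:A = Fin 0).

Lemma eta_gen (x : L) : exists q : {poly K}, x = (map_poly (in_alg L) q).[eta].
Proof.
have : x \in <<1; eta>>%VS.
  by case: AS_or_Kummer => [[_ -> _]|[[_ -> _] _]]; exact: memvf.
by move=> /Fadjoin_polyP[_ /polyOver1P[q ->] ->]; exists q.
Qed.

Lemma min_data : exists (g : {poly K}) (kappa : G),
  [/\ g \is monic, size g = p.+1, (map_poly (in_alg L) g).[eta] = 0,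
      v (map_poly (in_alg L) g^`()).[eta] = Fin kappa &
      forall cv : K -> G, (forall b, v (eta - b%:A) = Fin (cv b)) ->
      (independent v p eta a <->
       forall x : G, (exists b, x <= cv b) <-> x *+ p.-1 < kappa)].
Proof.
have p1 : (0 < p.-1)%N by rewrite -subn1 subn_gt0 prime_gt1.
have [[pK Le mE]|[[[z zp] Le mE] va]] := AS_or_Kummer.
  have sX : (size ('X + a%:P : {poly K})%R < size ('X^p : {poly K})%R)%N.
    by rewrite size_XaddC size_polyXn ltnS prime_gt1.
  exists ('X^p - 'X - a%:P), 0; split.
  - by rewrite -addrA -opprD monicE lead_coefDl ?size_polyN // lead_coefXn.
  - by rewrite -addrA -opprD size_polyDl ?size_polyN // size_polyXn.
  - by rewrite -mE; apply/eqP; apply: root_minPoly.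
  - rewrite !derivB derivXn derivX derivC subr0 -scaler_nat (pcharf0 pK).
    by rewrite scale0r sub0r rmorphN rmorph1 hornerN hornerC valN1.
  - move=> cv cvE; rewrite -(mul0rn G p.-1) -(dist_shift cvE arch 0 p1).
    split=> [[[_ [H cH e]]|[[[z zp] _ _]]]|[H cH e]].
    + by exists H => //; rewrite cut_shift0.
    + by have := prime_root_pchar pp zp; rewrite (pcharf0 pK) eqxx.
    + by left; split=> //; exists H => //; rewrite e cut_shift0.
have p0K := prime_root_pchar pp zp.
have veta : v eta = v 1.
  have e0 : eta ^+ p = a%:A.
    have : root (minPoly 1 eta) eta by apply: root_minPoly.
    rewrite mE rmorphB /= map_polyXn map_polyC /root hornerD hornerXn hornerN hornerC.
    by rewrite subr_eq0 => /eqP.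
  have eta0 : eta != 0.
    apply/eqP => e; move: va; rewrite -e0 e expr0n eqn0Ngt prime_gt0 //= Defs.val0.
    by [].
  have [h vh] := val_Fin v eta0; have := val_FinX p vh; rewrite e0 va vh Defs.val1 => -[h0].
  congr Fin; apply: le_anti; apply/andP.
  by split; rewrite -(@og_le_Mn _ p) ?prime_gt0 // -h0 mul0rn.
have pA : (p%:R : L) != 0 by rewrite -(rmorph_nat (in_alg L)) fmorph_eq0.
have [kappa vk] := val_Fin v pA.
exists ('X^p - a%:P), kappa; split.
- by rewrite monicXnsubC ?prime_gt0.
- by rewrite size_XnsubC ?prime_gt0.
- by rewrite -mE; apply/eqP; apply: root_minPoly.
- rewrite derivB derivXn derivC subr0 -mulr_natl rmorphM rmorph_nat /= map_polyXn.
  rewrite hornerM hornerXn mulrC -polyC_natr hornerC valMl1 //.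
  by rewrite (valX _ veta) expr1n.
- move=> cv cvE; split=> [[[[pK _ _] _]|[_ [alpha [ap hH]]]]|h].
  + by have := p0K; rewrite (pcharf0 pK) eqxx.
  + have <- : alpha *+ p.-1 = kappa by move: ap; rewrite vk => -[].
    exact/(dist_shift cvE arch alpha p1).
  + have [alpha ak] := gdiv kappa p1; right; split; first by split=> //; exists z.
    exists alpha; rewrite ak vk; split=> //.
    by apply/(dist_shift cvE arch alpha p1); rewrite ak.
Qed.

End Data.

Theorem proposition1p2
  (K : fieldType) (L : fieldExtType K)
  (G : orderedGroupType) (v : valuation L G)
  (Gdiv : divisible_closure (value_group v))
  (rk1 : rank_one (value_group v))
  (p : nat) (charp : p \in [pchar residue (comap (in_alg L) v)])
  (Omega : closedFieldType) (j : {rmorphism L -> Omega})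
  (Omega_alg : forall z : Omega, algebraicOver (j \o in_alg L) z)
  (eta : L) (a : K)
  (AS_or_Kummer : artin_schreier p eta a \/ (kummer p eta a /\ v a%:A = Fin 0))
  (defect_p : defect_is v j p)
  (nubar : valuation {poly Omega} G)
  (nubar_ext : forall f : {poly K},
     nubar (map_poly (j \o in_alg L) f) = nu_of v eta f) :
  [/\ forall n : nat, plateau (nu_of v eta) (j \o in_alg L) nubar n <-> n = 1%N,
      plateau_defect_is (nu_of v eta) (j \o in_alg L) nubar 1 p,
      bounded_in (nu_of v eta) (j \o in_alg L) nubar 1
    & exists I1 : {set 'I_1},
        is_plateau_set (nu_of v eta) (j \o in_alg L) nubar p 1 I1 /\
        (I1 = finset.set0 <-> dependent v p eta a)].
Proof.
have pp : prime p by case/andP: charp.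
have gdiv : forall (n : nat) (g : G), (0 < n)%N -> exists h, h *+ n = g by case: Gdiv.
have vL0 : value_group v 0 by exists 1; rewrite Defs.val1.
have arch : archimedean G.
  by apply: rank_one_archimedean rk1 Gdiv; split=> // x y; apply: value_groupB.
have [g [kappa [gm sg g_eta vk indE]]] := min_data pp arch gdiv AS_or_Kummer.
have gen := eta_gen AS_or_Kummer.
have g'_eta : (map_poly (in_alg L) g^`()).[eta] != 0 by rewrite -(val_PInf v) vk.
have [w0 [Kh [Lh [n [e [f [w0j [hK hL] deg [ie df] nE]]]]]]] := defect_p.
have np := rank_le Omega_alg gen gm sg g_eta hK hL deg.
have n0 : (0 < n)%N.
  case: (n) deg => // -[b [bL bU]]; have [[L1 _ _] _ _ _] := hL.
  have [c [[_ /eqP]]] := bU 1 L1; by rewrite big_ord0 oner_eq0.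
(* p e f = n <= p with n positive. *)
have ef : (e * f)%N = 1%N.
  apply/eqP; rewrite eqn_leq -(leq_pmul2l (prime_gt0 pp)) muln1 mulnA -nE np /=.
  by move: n0; rewrite nE -mulnA muln_gt0 => /andP[].
have e1 : e = 1%N by apply/eqP; move/eqP: ef; rewrite muln_eq1 => /andP[].
have f1 : f = 1%N by apply/eqP; move/eqP: ef; rewrite muln_eq1 => /andP[].
have n1 : (1 < n)%N by rewrite nE e1 f1 !muln1 prime_gt1.
rewrite e1 in ie; rewrite f1 in df.
have eta_b b : eta - b%:A != 0.
  rewrite subr_eq0; apply/eqP => eb; apply: (eta_notin_Kh gen hK hL deg n1).
  by rewrite eb; case: hK => _ EK _ _; apply: EK; exists b.
have [cv cvE] := choice (fun b => val_Fin v (eta_b b)).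
(* As the extension is immediate, some c in K has the value of eta - b and some d in K the residue
   of (eta - b) / c; then b + c d is nearer to eta. *)
have nomax b : exists b', cv b < cv b'.
  have [c vc] := index1_value ie (eta_b b).
  have c0 : c%:A != 0 :> L by rewrite -(val_PInf v) vc cvE.
  have vx : Fin 0 <= v ((eta - b%:A) / c%:A).
    by rewrite -(Defs.val1 v) -(val_le2r _ _ _ c0) mul1r mulfVK // vc.
  have [d vd] := degree1_residue df vx; exists (b + c * d).
  have := vd; rewrite -(Defs.val1 v) -(val_lt2r _ _ _ c0) mul1r mulrBl mulfVK // vc.
  have -> : eta - b%:A - d%:A * c%:A = eta - (b + c * d)%:A.
    rewrite -[(b + c * d)%:A]/(in_alg L (b + c * d)) rmorphD rmorphM /=.
    by rewrite opprD addrA [d%:A * _]mulrC.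
  by rewrite !cvE Fin_ltE.
have bnd : exists M, forall b, cv b <= M.
  have [M hM] := dist_bounded Omega_alg gen g_eta g'_eta w0j hK hL deg n1.
  by exists M => b; have := hM b; rewrite cvE Fin_le.
pose iota : {rmorphism K -> Omega} := j \o in_alg L.
have nug : nubar (map_poly iota g) = PInf.
  by rewrite nubar_ext /= [horner_alg _ _]g_eta Defs.val0.
have [y ny] := nubar_root (monic_map iota gm) nug.
have nubarE := nubar_horner ny; set w := comap polyC nubar in nubarE.
have nuE (h : {poly K}) : nu_of v eta h = w (map_poly iota h).[y].
  by rewrite -nubarE nubar_ext.
have wE b : w (y - iota b) = Fin (cv b).
  have := nuE ('X - b%:P); rewrite rmorphB /= map_polyX map_polyC hornerXsubC => <-.
  rewrite -cvE; change (v (map_poly (in_alg L) ('X - b%:P)).[eta] = v (eta - b%:A)).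
  by rewrite rmorphB /= map_polyX map_polyC hornerXsubC.
have wnuC b : w (iota b) = v b%:A.
  have := nuE b%:P; rewrite map_polyC hornerC => <-.
  by change (v (map_poly (in_alg L) b%:P).[eta] = v b%:A); rewrite map_polyC hornerC.
have wp : Fin 0 < w p%:R.
  have /andP[_ /eqP p0] := charp.
  have := @residue_eq _ _ (comap (in_alg L) v) p%:R 0.
  rewrite rmorph_nat p0 rmorph0 => /(_ erefl); rewrite !rmorph_nat rmorph0 subr0.
  by rewrite -(rmorph_nat iota) wnuC.
have wnat i : (0 < i < p)%N -> w i%:R = Fin 0.
  move=> /andP[i0 ip]; apply/esym/eqP; have := val_nat_ge0 w i.
  rewrite le_eqVlt => /orP[//|wi].
  have : coprime i p by rewrite coprime_sym prime_coprime // gtnNdvd.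
  (* In the relation 1 = u i - t p, positive values of i and p would give 1 a positive value. *)
  have [u t ut _] := egcdnP p i0; rewrite /coprime => /eqP cop.
  have : Fin 0 < w 1.
    have -> : 1 = u%:R * i%:R - t%:R * p%:R :> Omega.
      by rewrite -!natrM ut cop natrD addrC addKr.
    apply: val_ltD; rewrite ?valN Defs.valM -[X in Fin X]addr0 ext_addC;
      by apply: ext_ltD => //; apply: val_nat_ge0.
  by rewrite Defs.val1 ltxx.
have gy : (map_poly iota g).[y] = 0.
  by apply/eqP; rewrite -(val_PInf w) -nubarE nug.
have limg : limit_poly iota w y p g by split=> // b; rewrite gy (val_FinX _ (wE _)) val0 Fin_lt.
have wk : w (map_poly iota g \Po ('X + y%:P))`_1 = Fin kappa.
  by rewrite shift1 deriv_map -nuE -vk.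
split.
- exact: (plateauE arch wE nomax bnd pp wnat nubarE nuE limg gy).
- exact: (defect_Psi1 arch wE nomax bnd pp wnat nubarE nuE limg gy).
- exact: (bounded_Psi1 arch wE nomax bnd pp wnat nubarE nuE limg gy).
have [I1 [psI IE]] := plateau_setP arch wE nomax bnd pp wp wnat nubarE nuE limg gy.
exists I1; split=> //; rewrite IE /dependent (indE _ cvE).
rewrite (exceeds_pred_cut arch wE nomax bnd pp wnat gdiv limg wk).
by split=> [ab|]; [apply|apply: contrapT].
Qed.
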